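(* For every integer $m\geq 2$, $$\int_0^1\zeta_1(m,x)\,\zeta_1(m,1-x)\,dx=\frac{2\,\Gamma(2m-1)}{\Gamma(m)^2}\Bigl\{\bigl[\psi(m)-\psi(2m-1)\bigr]\bigl[\zeta(2m-1)-1\bigr]-\zeta'(2m-1)\Bigr\}-2\sum_{\substack{n=0\\ n\neq m-1}}^\infty \frac{(m)_n}{n!}\,\frac{\zeta(n+m)-1}{n+1-m}.$$
   Context: For $\Re(a)>1$ and $x\in[0,1]$, the auxiliary Hurwitz zeta function is $\zeta_1(a,x)=\sum_{k=1}^\infty (k+x)^{-a}=\zeta(a,x+1)$; for $x\in(0,1]$ it equals $\zeta(a,x)-x^{-a}$, where $\zeta(a,x)$ is the Hurwitz zeta function. $\zeta(s)$ is the Riemann zeta function, $\zeta'$ its derivative, $\psi=\Gamma'/\Gamma$ is the digamma function, and $(m)_n=m(m+1)\cdots(m+n-1)$ (with $(m)_0=1$) is the Pochhammer symbol. *)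

(* Defs.v *)
(* World: Stdlib reals with Coquelicot. *)
From Stdlib Require Import Arith Factorial Reals Lra Lia.
From Coquelicot Require Import Coquelicot.

Open Scope R_scope.

(* All functions below are Coquelicot's total operators; the intended domains
   are a > 1 and 0 <= x <= 1 for [zeta1], s > 1 for [zeta], and x > 0 for
   [Gamma] and [digamma]. *)

(* The index k = 1, 2, ... is shifted: the k-th term here is (k+1+x)^(-a). *)
Definition zeta1 (a x : R) : R :=
  Series (fun k : nat => Rpower (INR (S k) + x) (- a)).

Definition zeta (s : R) : R :=
  Series (fun k : nat => Rpower (INR (S k)) (- s)).

(* Euler's integral, improper at both endpoints. *)
Definition Gamma (x : R) : R :=
  RInt_gen (fun t : R => Rpower t (x - 1) * exp (- t))
    (at_right 0) (Rbar_locally p_infty).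

Definition digamma (x : R) : R := Derive Gamma x / Gamma x.

Fixpoint pochhammer (x : R) (n : nat) : R :=
  match n with
  | O => 1
  | S p => pochhammer x p * (x + INR p)
  end.

(* The term n = m - 1, whose denominator vanishes, is omitted from the series. *)
Definition summand (m n : nat) : R :=
  if Nat.eq_dec n (m - 1) then 0
  else pochhammer (INR m) n / INR (fact n)
       * ((zeta (INR n + INR m) - 1) / (INR n + 1 - INR m)).

(* Main.v *)
(* Integrating the Cauchy product of the two series term by term, and substituting u = k + x in
   each term, the terms with k + l + 1 = N add up to the integral of u^-m (N - u)^-m over
   [1, N - 1]. With P the antiderivative of t^-m (1 - t)^-m that is odd about 1/2, this is
   -2 N^(1-2m) P(1/N). At 0, P(t) = C(2m-2, m-1) ln t - const + sum_(n <> m-1) C(n+m-1, n)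
   t^(n+1-m) / (n+1-m), where const is C(2m-2, m-1) (psi(m) - psi(2m-1)); summing over N
   turns ln t into zeta', the constant into zeta(2m-1) - 1, and the powers into the series
   of the theorem. The partial fractions of P' and the remainder of its Taylor expansion both
   come from the Chaundy-Bullard identity. In the proofs m = p + 1. *)

Require Import Defs.
From Stdlib Require Import Factorial Reals Lra Lia.
From Coquelicot Require Import Coquelicot.

Open Scope R_scope.

Fixpoint psum (f : nat -> R) (n : nat) : R :=
  match n with
  | O => 0
  | S k => psum f k + f k
  end.

Lemma sum_n_psum (f : nat -> R) (n : nat) : sum_n f n = psum f (S n).
Proof.
  induction n as [|n IH].
  - rewrite sum_O; simpl; ring.
  - rewrite sum_Sn, IH; reflexivity.
Qed.

Lemma psum_ext (f g : nat -> R) (n : nat) :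
  (forall i, (i < n)%nat -> f i = g i) -> psum f n = psum g n.
Proof.
  induction n as [|n IH]; intros H; simpl; [reflexivity|].
  rewrite IH, H by auto with arith; reflexivity.
Qed.

Lemma psum_plus (f g : nat -> R) (n : nat) :
  psum (fun i => f i + g i) n = psum f n + psum g n.
Proof. induction n as [|n IH]; simpl; [ring|rewrite IH; ring]. Qed.

Lemma psum_scal (c : R) (f : nat -> R) (n : nat) :
  psum (fun i => c * f i) n = c * psum f n.
Proof. induction n as [|n IH]; simpl; [ring|rewrite IH; ring]. Qed.

Lemma psum_le (f g : nat -> R) (n : nat) :
  (forall i, (i < n)%nat -> f i <= g i) -> psum f n <= psum g n.
Proof.
  induction n as [|n IH]; intros H; simpl; [lra|].
  apply Rplus_le_compat; [apply IH; auto with arith|apply H; auto with arith].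
Qed.

Lemma psum_nonneg (f : nat -> R) (n : nat) :
  (forall i, (i < n)%nat -> 0 <= f i) -> 0 <= psum f n.
Proof.
  induction n as [|n IH]; intros H; simpl; [lra|].
  apply Rplus_le_le_0_compat; [apply IH; auto with arith|apply H; auto with arith].
Qed.

Lemma psum_shift (f : nat -> R) (n : nat) :
  psum f (S n) = f O + psum (fun i => f (S i)) n.
Proof.
  induction n as [|n IH]; [simpl; ring|].
  change (psum f (S (S n))) with (psum f (S n) + f (S n)).
  rewrite IH; simpl; ring.
Qed.

Lemma psum_add (f : nat -> R) (m n : nat) :
  psum f (m + n) = psum f m + psum (fun i => f (m + i)%nat) n.
Proof.
  induction n as [|n IH].
  - rewrite Nat.add_0_r; simpl; ring.
  - rewrite Nat.add_succ_r; simpl; rewrite IH; ring.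
Qed.

Lemma psum_telescope (f : nat -> R) (n : nat) :
  psum (fun i => f (S i) - f i) n = f n - f O.
Proof. induction n as [|n IH]; simpl; [ring|rewrite IH; ring]. Qed.

Lemma is_derive_psum (f : nat -> R -> R) (d : nat -> R) (n : nat) (x : R) :
  (forall i, (i < n)%nat -> is_derive (f i) x (d i)) ->
  is_derive (fun y => psum (fun i => f i y) n) x (psum d n).
Proof.
  induction n as [|n IH]; intros H; simpl.
  - apply (is_derive_const (K := R_AbsRing) (V := R_NormedModule) 0 x).
  - apply (is_derive_plus (K := R_AbsRing) (V := R_NormedModule)
      (fun y => psum (fun i => f i y) n) (f n)); auto with arith.
Qed.

Lemma is_RInt_psum (f : nat -> R -> R) (J : nat -> R) (a b : R) (n : nat) :
  (forall i, (i < n)%nat -> is_RInt (f i) a b (J i)) ->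
  is_RInt (fun x => psum (fun i => f i x) n) a b (psum J n).
Proof.
  induction n as [|n IH]; intros H; simpl.
  - evar_last; [apply (is_RInt_const (V := R_NormedModule) a b 0)|].
    apply Rmult_0_r.
  - apply (is_RInt_plus (V := R_NormedModule)); auto with arith.
Qed.

Lemma is_series_psum (u : nat -> nat -> R) (l : nat -> R) (n : nat) :
  (forall i, (i < n)%nat -> is_series (u i) (l i)) ->
  is_series (fun k => psum (fun i => u i k) n) (psum l n).
Proof.
  induction n as [|n IH]; intros H; simpl.
  - apply is_series_Reals. intros eps Heps. exists O. intros k _.
    rewrite <- sum_n_Reals, sum_n_const, Rmult_0_r, R_dist_eq; exact Heps.
  - apply (is_series_plus (K := R_AbsRing) (V := R_NormedModule)); auto with arith.
Qed.

Lemma binomial_0_r (n : nat) : Binomial.C n 0 = 1.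
Proof. unfold Binomial.C. rewrite Nat.sub_0_r. simpl. field. apply INR_fact_neq_0. Qed.

Lemma binomial_pos (n i : nat) : 0 < Binomial.C n i.
Proof.
  unfold Binomial.C. apply Rdiv_lt_0_compat; [|apply Rmult_lt_0_compat];
    apply INR_fact_lt_0.
Qed.

Lemma binomial_add_pascal (p i : nat) :
  Binomial.C (S p + S i) (S i) = Binomial.C (p + S i) (S i) + Binomial.C (S p + i) i.
Proof.
  change (S p + S i)%nat with (S (p + S i)).
  rewrite <- pascal by lia.
  replace (p + S i)%nat with (S p + i)%nat by lia. ring.
Qed.

Lemma binomial_add_sym (p q : nat) : Binomial.C (p + q) q = Binomial.C (q + p) p.
Proof.
  rewrite (pascal_step1 (p + q) q) by lia.
  replace (p + q - q)%nat with p by lia. now rewrite Nat.add_comm.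
Qed.

Lemma binomial_pochhammer (p n : nat) :
  pochhammer (INR (S p)) n / INR (fact n) = Binomial.C (p + n) n.
Proof.
  unfold Binomial.C. replace (p + n - n)%nat with p by lia.
  assert (H : pochhammer (INR (S p)) n * INR (fact p) = INR (fact (p + n))).
  { induction n as [|n IH].
    - rewrite Nat.add_0_r; simpl; ring.
    - replace (p + S n)%nat with (S (p + n)) by lia.
      change (fact (S (p + n))) with ((S (p + n)) * fact (p + n))%nat.
      rewrite mult_INR, <- IH, (S_INR (p + n)), plus_INR.
      change (pochhammer (INR (S p)) (S n))
        with (pochhammer (INR (S p)) n * (INR (S p) + INR n)).
      rewrite S_INR. ring. }
  rewrite <- H. field. split; apply INR_fact_neq_0.
Qed.

Lemma binomial_sum_pascal (p q : nat) (y : R) :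
  psum (fun i => Binomial.C (p + i) i * y ^ i) (S q)
  - (1 - y) * psum (fun i => Binomial.C (S p + i) i * y ^ i) (S q)
  = Binomial.C (S p + q) q * y ^ S q.
Proof.
  induction q as [|q IH].
  - simpl psum. rewrite !binomial_0_r. ring.
  - change (psum ?f (S (S q))) with (psum f (S q) + f (S q)). cbv beta.
    rewrite Rmult_plus_distr_l.
    replace (psum (fun i => Binomial.C (p + i) i * y ^ i) (S q)) with
      ((1 - y) * psum (fun i => Binomial.C (S p + i) i * y ^ i) (S q)
       + Binomial.C (S p + q) q * y ^ S q) by lra.
    rewrite (binomial_add_pascal p q). simpl pow. ring.
Qed.

Lemma chaundy_bullard (p q : nat) (t : R) :
  (1 - t) ^ S q * psum (fun i => Binomial.C (q + i) i * t ^ i) (S p)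
  + t ^ S p * psum (fun i => Binomial.C (p + i) i * (1 - t) ^ i) (S q) = 1.
Proof.
  induction p as [|p IH].
  - simpl psum at 1. rewrite binomial_0_r.
    assert (H : psum (fun i => Binomial.C (0 + i) i * (1 - t) ^ i) (S q) * t
                = 1 - (1 - t) ^ S q).
    { clear. induction q as [|q IH].
      - simpl. rewrite binomial_0_r. ring.
      - change (psum ?f (S (S q))) with (psum f (S q) + f (S q)). cbv beta.
        rewrite Rmult_plus_distr_r, IH, (binomial_add_sym 0), Nat.add_0_r, binomial_0_r.
        simpl. ring. }
    rewrite pow_1, (Rmult_comm t), H. ring.
  - change (psum ?f (S (S p))) with (psum f (S p) + f (S p)). cbv beta.
    pose proof (binomial_sum_pascal p q (1 - t)) as H.
    rewrite (binomial_add_sym q (S p)).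
    replace (1 - (1 - t)) with t in H by ring.
    rewrite <- IH at 2.
    replace (psum (fun i => Binomial.C (p + i) i * (1 - t) ^ i) (S q)) with
      (t * psum (fun i => Binomial.C (S p + i) i * (1 - t) ^ i) (S q)
       + Binomial.C (S p + q) q * (1 - t) ^ S q) by lra.
    change (t ^ S (S p)) with (t * t ^ S p). ring.
Qed.

Lemma binomial_harmonic (p q : nat) :
  psum (fun i => Binomial.C (q + i) i / INR (p - i)) p
  = Binomial.C (p + q) q * psum (fun i => / INR (q + S i)) p.
Proof.
  revert p. induction q as [|q IHq]; intros p.
  - rewrite Nat.add_0_r, binomial_0_r, Rmult_1_l.
    induction p as [|p IHp]; [reflexivity|].
    rewrite psum_shift.
    replace (psum (fun i => Binomial.C (0 + S i) (S i) / INR (S p - S i)) p)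
      with (psum (fun i => Binomial.C (0 + i) i / INR (p - i)) p).
    + rewrite IHp, Nat.add_0_r, binomial_0_r, Nat.sub_0_r.
      change (psum ?f (S p)) with (psum f p + f p). cbv beta.
      change (0 + S p)%nat with (S p). unfold Rdiv. ring.
    + apply psum_ext. intros i Hi.
      rewrite !(binomial_add_sym 0), !Nat.add_0_r, !binomial_0_r. reflexivity.
  - induction p as [|p IHp]; [simpl; ring|].
    assert (E : psum (fun i => Binomial.C (S q + i) i / INR (S p - i)) (S p)
                = psum (fun i => Binomial.C (q + i) i / INR (S p - i)) (S p)
                  + psum (fun i => Binomial.C (S q + i) i / INR (p - i)) p).
    { rewrite (psum_shift (fun i => Binomial.C (S q + i) i / INR (S p - i))),
        (psum_shift (fun i => Binomial.C (q + i) i / INR (S p - i))).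
      rewrite !Nat.add_0_r, !binomial_0_r, Rplus_assoc. f_equal.
      rewrite <- psum_plus. apply psum_ext. intros i Hi.
      rewrite binomial_add_pascal.
      replace (S p - S i)%nat with (p - i)%nat by lia. unfold Rdiv. ring. }
    rewrite E, IHp, IHq, psum_shift, binomial_add_pascal.
    replace (psum (fun i => / INR (q + S (S i))) p)
      with (psum (fun i => / INR (S q + S i)) p)
      by (apply psum_ext; intros i _; do 2 f_equal; lia).
    change (psum ?f (S p)) with (psum f p + f p). cbv beta.
    assert (A : Binomial.C (p + S q) (S q) = Binomial.C (S p + q) q * INR (S p) / INR (S q)).
    { unfold Binomial.C.
      replace (p + S q - S q)%nat with p by lia.
      replace (S p + q - q)%nat with (S p) by lia.
      replace (p + S q)%nat with (S p + q)%nat by lia.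
      change (fact (S q)) with (S q * fact q)%nat.
      change (fact (S p)) with (S p * fact p)%nat.
      rewrite !mult_INR. field.
      repeat split; try apply INR_fact_neq_0; apply not_0_INR; lia. }
    rewrite A.
    replace (q + 1)%nat with (S q) by lia.
    replace (S q + S p)%nat with (S (S q + p)) by lia.
    rewrite !S_INR, plus_INR, S_INR.
    field.
    pose proof (pos_INR p); pose proof (pos_INR q). split; lra.
Qed.

(* An antiderivative of [t^-(p+1) (1-t)^-(p+1)] on (0,1), odd about [1/2]. *)
Definition beta_prim (p : nat) (t : R) : R :=
  psum (fun i => Binomial.C (p + i) i / INR (p - i)
                 * (/ (1 - t) ^ (p - i) - / t ^ (p - i))) p
  + Binomial.C (p + p) p * (ln t - ln (1 - t)).

Lemma beta_prim_opp (p : nat) (t : R) : beta_prim p (1 - t) = - beta_prim p t.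
Proof.
  unfold beta_prim. replace (1 - (1 - t)) with t by ring.
  replace (psum _ p) with
    (- 1 * psum (fun i => Binomial.C (p + i) i / INR (p - i)
                 * (/ (1 - t) ^ (p - i) - / t ^ (p - i))) p); [ring|].
  rewrite <- psum_scal. apply psum_ext. intros i _. ring.
Qed.

Lemma is_derive_inv_pow_div (k : nat) (t : R) :
  t <> 0 -> is_derive (fun t => / t ^ S k / INR (S k)) t (- / t ^ S (S k)).
Proof.
  intros Ht.
  assert (Hk : INR (S k) <> 0) by (apply not_0_INR; lia).
  auto_derive; [exact (pow_nonzero t (S k) Ht)|].
  change (pred (S k)) with k.
  change (t * t ^ k) with (t ^ S k).
  change (match k with 0%nat => 1 | S _ => INR k + 1 end) with (INR (S k)).
  simpl pow. field. repeat split; auto using pow_nonzero.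
Qed.

Lemma is_derive_inv_pow_div_sub (k : nat) (t : R) :
  t <> 1 -> is_derive (fun t => / (1 - t) ^ S k / INR (S k)) t (/ (1 - t) ^ S (S k)).
Proof.
  intros Ht.
  evar_last.
  - apply (is_derive_comp (fun u => / u ^ S k / INR (S k)) (fun t => 1 - t) t).
    + apply is_derive_inv_pow_div. lra.
    + auto_derive; [exact I|reflexivity].
  - change (-(1) * - / (1 - t) ^ S (S k) = / (1 - t) ^ S (S k)). ring.
Qed.

(* [beta_prim] with its singular part at [0] removed, normalised to vanish there. *)
Definition beta_reg (p : nat) (t : R) : R :=
  psum (fun i => Binomial.C (p + i) i / INR (p - i) * (/ (1 - t) ^ (p - i) - 1)) p
  - Binomial.C (p + p) p * ln (1 - t).

Definition beta_reg' (p : nat) (t : R) : R :=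
  psum (fun i => Binomial.C (p + i) i * / (1 - t) ^ (S p - i)) (S p).

Lemma is_derive_beta_reg (p : nat) (t : R) :
  t < 1 -> is_derive (beta_reg p) t (beta_reg' p t).
Proof.
  intros Ht. unfold beta_reg, beta_reg'.
  change (psum ?f (S p)) with (psum f p + f p). cbv beta.
  apply (is_derive_plus (K := R_AbsRing) (V := R_NormedModule)
    (fun t => psum (fun i => Binomial.C (p + i) i / INR (p - i)
                             * (/ (1 - t) ^ (p - i) - 1)) p)
    (fun t => - (Binomial.C (p + p) p * ln (1 - t)))).
  - apply is_derive_psum. intros i Hi.
    destruct (p - i)%nat as [|k] eqn:E; [lia|].
    replace (S p - i)%nat with (S (S k)) by lia.
    apply is_derive_ext with
      (fun t => Binomial.C (p + i) i * (/ (1 - t) ^ S k / INR (S k) - / INR (S k))).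
    { intros u. change (@eq R_NormedModule) with (@eq R). cbv beta. unfold Rdiv. ring. }
    apply (is_derive_scal (fun t => / (1 - t) ^ S k / INR (S k) - / INR (S k))).
    evar_last.
    + apply (is_derive_minus (K := R_AbsRing) (V := R_NormedModule)
        (fun t => / (1 - t) ^ S k / INR (S k)) (fun _ => / INR (S k))).
      * apply is_derive_inv_pow_div_sub. lra.
      * apply is_derive_const.
    + apply Rminus_0_r.
  - replace (S p - p)%nat with 1%nat by lia.
    auto_derive; [lra|]. rewrite pow_1. field. lra.
Qed.

Lemma beta_prim_reg (p : nat) (t : R) :
  beta_prim p t
  = beta_reg p t + psum (fun i => Binomial.C (p + i) i / INR (p - i)) p
    - psum (fun i => Binomial.C (p + i) i / INR (p - i) * / t ^ (p - i)) p
    + Binomial.C (p + p) p * ln t.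
Proof.
  unfold beta_prim, beta_reg.
  replace (psum (fun i => Binomial.C (p + i) i / INR (p - i)
                 * (/ (1 - t) ^ (p - i) - / t ^ (p - i))) p) with
    (psum (fun i => Binomial.C (p + i) i / INR (p - i) * (/ (1 - t) ^ (p - i) - 1)) p
     + psum (fun i => Binomial.C (p + i) i / INR (p - i)) p
     + -1 * psum (fun i => Binomial.C (p + i) i / INR (p - i) * / t ^ (p - i)) p).
  - ring.
  - rewrite <- psum_scal, <- !psum_plus. apply psum_ext. intros i _. ring.
Qed.

(* Chaundy-Bullard at [q = p] is the partial fraction expansion of [t^-(p+1) (1-t)^-(p+1)]. *)
Lemma is_derive_beta_prim (p : nat) (t : R) :
  0 < t < 1 -> is_derive (beta_prim p) t (/ (t ^ S p * (1 - t) ^ S p)).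
Proof.
  intros Ht.
  replace (/ (t ^ S p * (1 - t) ^ S p)) with
    (beta_reg' p t - -1 * psum (fun i => Binomial.C (p + i) i * / t ^ (S p - i)) (S p)).
  - set (f := fun t => (beta_reg p t + psum (fun i => Binomial.C (p + i) i / INR (p - i)) p)
      - (psum (fun i => Binomial.C (p + i) i / INR (p - i) * / t ^ (p - i)) p
         - Binomial.C (p + p) p * ln t)).
    apply is_derive_ext with f.
    { intros u. rewrite beta_prim_reg. unfold f. change (@eq R_NormedModule) with (@eq R). ring. }
    apply (is_derive_minus (K := R_AbsRing) (V := R_NormedModule)
      (fun t => beta_reg p t + psum (fun i => Binomial.C (p + i) i / INR (p - i)) p)
      (fun t => psum (fun i => Binomial.C (p + i) i / INR (p - i) * / t ^ (p - i)) p
         - Binomial.C (p + p) p * ln t)).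
    + evar_last.
      * apply (is_derive_plus (K := R_AbsRing) (V := R_NormedModule) (beta_reg p)).
        -- apply is_derive_beta_reg. lra.
        -- apply is_derive_const.
      * apply Rplus_0_r.
    + rewrite <- psum_scal.
      change (psum ?f (S p)) with (psum f p + f p). cbv beta.
      apply (is_derive_plus (K := R_AbsRing) (V := R_NormedModule)
        (fun t => psum (fun i => Binomial.C (p + i) i / INR (p - i) * / t ^ (p - i)) p)
        (fun t => - (Binomial.C (p + p) p * ln t))).
      * apply is_derive_psum. intros i Hi.
        destruct (p - i)%nat as [|k] eqn:E; [lia|].
        replace (S p - i)%nat with (S (S k)) by lia.
        apply is_derive_ext with
          (fun t => Binomial.C (p + i) i * (/ t ^ S k / INR (S k))).
        { intros u. change (@eq R_NormedModule) with (@eq R). cbv beta. unfold Rdiv. ring. }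
        evar_last.
        -- apply (is_derive_scal (fun t => / t ^ S k / INR (S k))).
           apply is_derive_inv_pow_div. lra.
        -- change (Binomial.C (p + i) i * - / t ^ S (S k)
             = -1 * (Binomial.C (p + i) i * / t ^ S (S k))). ring.
      * replace (S p - p)%nat with 1%nat by lia.
        auto_derive; [lra|]. rewrite pow_1. field. lra.
  - pose proof (chaundy_bullard p p t) as H.
    unfold beta_reg'.
    assert (E : forall u, u <> 0 ->
      psum (fun i => Binomial.C (p + i) i * / u ^ (S p - i)) (S p)
      = / u ^ S p * psum (fun i => Binomial.C (p + i) i * u ^ i) (S p)).
    { intros u Hu. rewrite <- psum_scal. apply psum_ext. intros i Hi.
      replace (S p) with (S p - i + i)%nat at 2 by lia.
      rewrite pow_add. field. split; apply pow_nonzero; exact Hu. }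
    rewrite !E by lra.
    assert (t ^ S p <> 0) by (apply pow_nonzero; lra).
    assert ((1 - t) ^ S p <> 0) by (apply pow_nonzero; lra).
    apply Rmult_eq_reg_r with (t ^ S p * (1 - t) ^ S p);
      [|apply Rmult_integral_contrapositive; auto].
    rewrite Rinv_l by (apply Rmult_integral_contrapositive; auto).
    etransitivity; [|exact H]. field. auto.
Qed.

(* Taylor polynomial of [beta_reg p] at [0], of degree [K]. *)
Definition beta_trunc (p K : nat) (t : R) : R :=
  psum (fun j => Binomial.C (p + (S p + j)) (S p + j) / INR (S j) * t ^ S j) K.

Lemma is_derive_beta_trunc (p K : nat) (t : R) :
  is_derive (beta_trunc p K) t
    (psum (fun j => Binomial.C (p + (S p + j)) (S p + j) * t ^ j) K).
Proof.
  apply is_derive_psum. intros j _.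
  set (c := Binomial.C _ _).
  auto_derive; [exact I|]. change (pred (S j)) with j.
  change (match j with 0%nat => 1 | S _ => INR j + 1 end) with (INR (S j)).
  field. apply not_0_INR; lia.
Qed.

Lemma beta_reg'_remainder (p K : nat) (t : R) :
  0 < t < 1 ->
  beta_reg' p t - psum (fun j => Binomial.C (p + (S p + j)) (S p + j) * t ^ j) K
  = t ^ K * / (1 - t) ^ S p
    * psum (fun i => Binomial.C (p + K + i) i * (1 - t) ^ i) (S p).
Proof.
  intros Ht.
  assert (Hu : t ^ S p <> 0) by (apply pow_nonzero; lra).
  assert (Hv : (1 - t) ^ S p <> 0) by (apply pow_nonzero; lra).
  assert (E : beta_reg' p t
    = / (1 - t) ^ S p * psum (fun i => Binomial.C (p + i) i * (1 - t) ^ i) (S p)).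
  { unfold beta_reg'. rewrite <- psum_scal. apply psum_ext. intros i Hi.
    replace (S p) with (S p - i + i)%nat at 2 by lia.
    rewrite pow_add. field. split; apply pow_nonzero; lra. }
  rewrite E.
  pose proof (chaundy_bullard p p t) as H1.
  pose proof (chaundy_bullard (p + K) p t) as H2.
  change (S (p + K)) with (S p + K)%nat in H2.
  rewrite psum_add in H2.
  replace (psum (fun i => Binomial.C (p + (S p + i)) (S p + i) * t ^ (S p + i)) K)
    with (t ^ S p * psum (fun j => Binomial.C (p + (S p + j)) (S p + j) * t ^ j) K) in H2
    by (rewrite <- psum_scal; apply psum_ext; intros i _; rewrite pow_add; ring).
  rewrite pow_add in H2.
  set (X := psum (fun j => Binomial.C (p + (S p + j)) (S p + j) * t ^ j) K) in *.
  set (W := psum (fun i => Binomial.C (p + i) i * (1 - t) ^ i) (S p)) in *.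
  set (Z := psum (fun i => Binomial.C (p + K + i) i * (1 - t) ^ i) (S p)) in *.
  apply Rmult_eq_reg_l with (t ^ S p * (1 - t) ^ S p);
    [|apply Rmult_integral_contrapositive; auto].
  transitivity (t ^ S p * W - t ^ S p * (1 - t) ^ S p * X); [field; auto|].
  transitivity (t ^ S p * t ^ K * Z); [|field; auto].
  lra.
Qed.

Lemma beta_reg_remainder (p : nat) :
  exists A, 0 <= A /\ forall K t, 0 < t <= / 2 ->
    0 <= beta_reg p t - beta_trunc p K t <= A * (2 / 3) ^ K.
Proof.
  exists (2 ^ S p * (4 ^ p * (4 / 3) ^ S p)). split.
  { apply Rmult_le_pos; [|apply Rmult_le_pos]; apply pow_le; lra. }
  intros K t Ht.
  destruct (MVT_cor2 (fun t => beta_reg p t - beta_trunc p K t)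
    (fun t => beta_reg' p t
      - psum (fun j => Binomial.C (p + (S p + j)) (S p + j) * t ^ j) K) 0 t)
    as [c [Hc1 Hc2]]; [lra| |].
  { intros c Hc. apply is_derive_Reals.
    apply (is_derive_minus (K := R_AbsRing) (V := R_NormedModule) (beta_reg p) (beta_trunc p K)).
    - apply is_derive_beta_reg. lra.
    - apply is_derive_beta_trunc. }
  assert (H0 : beta_reg p 0 - beta_trunc p K 0 = 0).
  { assert (E1 : beta_reg p 0 = 0).
    { unfold beta_reg. rewrite Rminus_0_r, ln_1.
      rewrite (psum_ext _ (fun i => 0 * 0)).
      - rewrite psum_scal. ring.
      - intros i _. rewrite pow1, Rinv_1. ring. }
    assert (E2 : beta_trunc p K 0 = 0).
    { unfold beta_trunc. rewrite (psum_ext _ (fun i => 0 * 0)).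
      - rewrite psum_scal. ring.
      - intros i _. simpl pow. ring. }
    rewrite E1, E2. ring. }
  cbv beta in Hc1. rewrite H0, !Rminus_0_r in Hc1. rewrite Hc1.
  rewrite beta_reg'_remainder by lra. clear Hc1 H0.
  set (Z := psum _ _).
  assert (HZ0 : 0 <= Z).
  { apply psum_nonneg. intros i _. apply Rmult_le_pos;
      [apply Rlt_le, binomial_pos|apply pow_le; lra]. }
  assert (HZ : Z <= 4 ^ p * (4 / 3) ^ S (p + K)).
  { pose proof (chaundy_bullard (p + K) p (3 / 4)) as H.
    replace (1 - 3 / 4) with (/ 4) in H by field.
    assert (HX : 0 <= psum (fun i => Binomial.C (p + i) i * (3 / 4) ^ i) (S (p + K))).
    { apply psum_nonneg. intros i _. apply Rmult_le_pos;
        [apply Rlt_le, binomial_pos|apply pow_le; lra]. }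
    assert (Hq : 0 <= (/ 4) ^ S p) by (apply pow_le; lra).
    set (Y := psum (fun i => Binomial.C (p + K + i) i * (/ 4) ^ i) (S p)) in H.
    assert (HY : (3 / 4) ^ S (p + K) * Y <= 1) by (pose proof (Rmult_le_pos _ _ Hq HX); lra).
    assert (HZY : Z <= 4 ^ p * Y).
    { unfold Z, Y. rewrite <- psum_scal. apply psum_le. intros i Hi.
      replace (4 ^ p) with (4 ^ (p - i) * 4 ^ i) by (rewrite <- pow_add; f_equal; lia).
      rewrite pow_inv.
      replace (4 ^ (p - i) * 4 ^ i * (Binomial.C (p + K + i) i * / 4 ^ i))
        with (Binomial.C (p + K + i) i * 4 ^ (p - i)) by (field; apply pow_nonzero; lra).
      apply Rmult_le_compat_l; [apply Rlt_le, binomial_pos|].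
      apply Rle_trans with (1 ^ i); [apply pow_incr; lra|].
      rewrite pow1. apply pow_R1_Rle. lra. }
    apply Rle_trans with (1 := HZY). apply Rmult_le_compat_l; [apply pow_le; lra|].
    replace (4 / 3) with (/ (3 / 4)) by field.
    rewrite pow_inv.
    apply Rmult_le_reg_l with ((3 / 4) ^ S (p + K)); [apply pow_lt; lra|].
    rewrite Rinv_r; [exact HY|apply pow_nonzero; lra]. }
  assert (Hc3 : 0 <= c ^ K <= (/ 2) ^ K) by (split; [apply pow_le|apply pow_incr]; lra).
  assert (Hc4 : 0 <= / (1 - c) ^ S p <= 2 ^ S p).
  { rewrite <- pow_inv.
    assert (0 < / (1 - c) <= 2).
    { split; [apply Rinv_0_lt_compat; lra|].
      apply Rle_trans with (/ / 2); [apply Rinv_le_contravar; lra|rewrite Rinv_inv; lra]. }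
    split; [apply pow_le|apply pow_incr]; lra. }
  assert (HA : 2 ^ S p * (4 ^ p * (4 / 3) ^ S p) * (2 / 3) ^ K
    = (/ 2) ^ K * 2 ^ S p * (4 ^ p * (4 / 3) ^ S (p + K)) * 1).
  { replace (2 / 3) with (/ 2 * (4 / 3)) by field.
    change (S (p + K)) with (S p + K)%nat. rewrite Rpow_mult_distr, pow_add. ring. }
  rewrite HA. clear HA.
  revert Hc3 Hc4 HZ.
  generalize (c ^ K) ((/ 2) ^ K) (/ (1 - c) ^ S p) (2 ^ S p) (4 ^ p * (4 / 3) ^ S (p + K)).
  intros x1 x2 x3 x4 x5 Hc3 Hc4 HZ.
  split.
  - repeat apply Rmult_le_pos; lra.
  - repeat apply Rmult_le_compat; try (repeat apply Rmult_le_pos); lra.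
Qed.

Lemma exp_le_mono (x y : R) : x <= y -> exp x <= exp y.
Proof.
  intros [H|H]; [|subst]; [apply Rlt_le, exp_increasing, H|apply Rle_refl].
Qed.

Lemma exp_taylor1 (y : R) : Rabs (exp y - 1 - y) <= y ^ 2 * exp (Rabs y).
Proof.
  pose proof (exp_ineq1_le y) as H1. pose proof (exp_ineq1_le (- y)) as H2.
  pose proof (exp_pos y) as H3.
  assert (H4 : exp y * exp (- y) = 1) by (rewrite <- exp_plus, Rplus_opp_r; apply exp_0).
  assert (H5 : exp y - 1 <= y * exp y) by nra.
  rewrite Rabs_pos_eq by lra.
  destruct (Rle_dec 0 y) as [Hy|Hy].
  - rewrite Rabs_pos_eq by exact Hy. nra.
  - assert (1 <= exp (Rabs y)).
    { rewrite <- exp_0. apply exp_le_mono, Rabs_pos. }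
    assert (y ^ 2 * 1 <= y ^ 2 * exp (Rabs y)) by (apply Rmult_le_compat_l; nra).
    nra.
Qed.

Lemma sqr_le_exp (u : R) : u ^ 2 <= 16 * exp (Rabs u / 2).
Proof.
  pose proof (exp_ineq1_le (Rabs u / 4)) as H. pose proof (Rabs_pos u).
  replace (Rabs u / 2) with (Rabs u / 4 + Rabs u / 4) by field.
  rewrite exp_plus, <- (pow2_abs u). nra.
Qed.

Lemma exp_Rabs_le (u : R) : exp (Rabs u) <= exp u + exp (- u).
Proof.
  pose proof (exp_pos u); pose proof (exp_pos (- u)).
  unfold Rabs; destruct (Rcase_abs u); lra.
Qed.

Lemma exp_mult_taylor1 (c u h : R) :
  Rabs h <= / 2 ->
  Rabs (exp ((c + h) * u) - exp (c * u) - h * (u * exp (c * u)))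
  <= 16 * (exp ((c + 1) * u) + exp ((c - 1) * u)) * h ^ 2.
Proof.
  intros Hh.
  replace (exp ((c + h) * u) - exp (c * u) - h * (u * exp (c * u)))
    with (exp (c * u) * (exp (h * u) - 1 - h * u))
    by (replace ((c + h) * u) with (c * u + h * u) by ring; rewrite exp_plus; ring).
  replace (16 * (exp ((c + 1) * u) + exp ((c - 1) * u)) * h ^ 2)
    with (exp (c * u) * (16 * h ^ 2 * (exp u + exp (- u))))
    by (replace ((c + 1) * u) with (c * u + u) by ring;
        replace ((c - 1) * u) with (c * u + - u) by ring; rewrite !exp_plus; ring).
  rewrite Rabs_mult, (Rabs_pos_eq (exp _)) by apply Rlt_le, exp_pos.
  apply Rmult_le_compat_l; [apply Rlt_le, exp_pos|].
  apply Rle_trans with (1 := exp_taylor1 _).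
  apply Rle_trans with (h ^ 2 * (16 * exp (Rabs u / 2)) * exp (Rabs u / 2)).
  - apply Rmult_le_compat; [apply pow2_ge_0|apply Rlt_le, exp_pos| |].
    + rewrite Rpow_mult_distr. apply Rmult_le_compat_l; [apply pow2_ge_0|apply sqr_le_exp].
    + apply exp_le_mono. rewrite Rabs_mult. pose proof (Rabs_pos u). nra.
  - apply Rle_trans with (16 * h ^ 2 * exp (Rabs u)).
    + right. replace (Rabs u) with (Rabs u / 2 + Rabs u / 2) at 3 by field.
      rewrite exp_plus. ring.
    + apply Rmult_le_compat_l; [pose proof (pow2_ge_0 h); lra|apply exp_Rabs_le].
Qed.

Lemma Rabs_mult_exp_le (c u : R) :
  Rabs (u * exp (c * u)) <= exp ((c + 1) * u) + exp ((c - 1) * u).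
Proof.
  replace ((c + 1) * u) with (c * u + u) by ring.
  replace ((c - 1) * u) with (c * u + - u) by ring.
  rewrite !exp_plus, Rabs_mult, (Rabs_pos_eq (exp _)) by apply Rlt_le, exp_pos.
  pose proof (exp_ineq1_le (Rabs u)). pose proof (exp_Rabs_le u).
  pose proof (exp_pos (c * u)). nra.
Qed.

Lemma is_derive_of_quadratic_error (f : R -> R) (x l M : R) :
  (forall h, Rabs h <= / 2 -> Rabs (f (x + h) - f x - h * l) <= M * h ^ 2) ->
  is_derive f x l.
Proof.
  intros H. apply is_derive_Reals. intros eps Heps.
  assert (HM : 0 <= M).
  { pose proof (H (/ 2)) as H1. rewrite Rabs_pos_eq in H1 by lra.
    specialize (H1 (Rle_refl _)).
    pose proof (Rabs_pos (f (x + / 2) - f x - / 2 * l)). lra. }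
  assert (Hd : 0 < Rmin (/ 2) (eps / (M + 1))).
  { apply Rmin_pos; [lra|apply Rdiv_lt_0_compat; lra]. }
  exists (mkposreal _ Hd). intros h Hh0 Hh. simpl in Hh.
  pose proof (Rmin_l (/ 2) (eps / (M + 1))). pose proof (Rmin_r (/ 2) (eps / (M + 1))).
  assert (Hp : 0 < Rabs h) by (apply Rabs_pos_lt; exact Hh0).
  replace ((f (x + h) - f x) / h - l) with ((f (x + h) - f x - h * l) / h) by (field; exact Hh0).
  unfold Rdiv. rewrite Rabs_mult, Rabs_inv.
  apply Rmult_lt_reg_r with (Rabs h); [exact Hp|].
  rewrite Rmult_assoc, Rinv_l, Rmult_1_r by lra.
  apply Rle_lt_trans with (1 := H h ltac:(lra)).
  rewrite <- (pow2_abs h).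
  assert (H2 : (M + 1) * Rabs h < eps).
  { apply Rlt_le_trans with ((M + 1) * (eps / (M + 1))).
    - apply Rmult_lt_compat_l; lra.
    - right. field. lra. }
  nra.
Qed.

Lemma Rinv_INR_S_lim : is_lim_seq (fun n => / INR (S n)) 0.
Proof.
  apply (is_lim_seq_incr_1 (fun n => / INR n)).
  replace (Finite 0) with (Rbar_inv p_infty) by reflexivity.
  apply is_lim_seq_inv; [apply is_lim_seq_INR|discriminate].
Qed.

Lemma ex_series_inv_sqr : ex_series (fun k => / INR (S k) ^ 2).
Proof.
  apply (ex_series_le (K := R_AbsRing) (V := R_CompleteNormedModule) _
    (fun k => 2 * (/ INR (S k) - / INR (S (S k))))).
  - intros k. change (Rabs (/ INR (S k) ^ 2) <= 2 * (/ INR (S k) - / INR (S (S k)))).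
    rewrite (S_INR (S k)).
    assert (1 <= INR (S k)) by (rewrite S_INR; pose proof (pos_INR k); lra).
    rewrite Rabs_pos_eq by (apply Rlt_le, Rinv_0_lt_compat, pow_lt; lra).
    set (x := INR (S k)) in *.
    replace (2 * (/ x - / (x + 1))) with (/ x ^ 2 * (2 * x / (x + 1))) by (field; lra).
    rewrite <- (Rmult_1_r (/ x ^ 2)) at 1.
    apply Rmult_le_compat_l; [apply Rlt_le, Rinv_0_lt_compat, pow_lt; lra|].
    apply Rmult_le_reg_r with (x + 1); [lra|].
    replace (2 * x / (x + 1) * (x + 1)) with (2 * x) by (field; lra). lra.
  - exists 2.
    apply filterlim_ext with (fun n => 2 * (1 - / INR (S (S n)))).
    { intros n. rewrite sum_n_psum, psum_scal. f_equal.
      rewrite (psum_ext _ (fun i => - / INR (S (S i)) - - / INR (S i))) by (intros; ring).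
      rewrite (psum_telescope (fun i => - / INR (S i))). simpl (INR 1). field.
      apply not_0_INR; lia. }
    apply (is_lim_seq_ext (fun n => 2 * (1 - / INR (S (S n)))) _ 2 (fun n => eq_refl)).
    evar_last.
    + apply is_lim_seq_scal_l. apply is_lim_seq_minus'; [apply is_lim_seq_const|].
      apply (is_lim_seq_incr_1 (fun n => / INR (S n))), Rinv_INR_S_lim.
    + simpl. f_equal. ring.
Qed.

Lemma Rpower_INR_S_le (k : nat) (s : R) :
  2 <= s -> 0 < Rpower (INR (S k)) (- s) <= / INR (S k) ^ 2.
Proof.
  intros Hs. split; [apply exp_pos|].
  rewrite <- Rpower_pow, <- Rpower_Ropp by (apply lt_0_INR; lia).
  apply Rle_Rpower; [rewrite S_INR; pose proof (pos_INR k); lra|simpl; lra].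
Qed.

Lemma is_series_zeta (s : R) :
  2 <= s -> is_series (fun k => Rpower (INR (S k)) (- s)) (zeta s).
Proof.
  intros Hs. apply Series_correct.
  apply (ex_series_le (K := R_AbsRing) (V := R_CompleteNormedModule) _
    (fun k => / INR (S k) ^ 2)); [|exact ex_series_inv_sqr].
  intros k. pose proof (Rpower_INR_S_le k s Hs) as H.
  change (Rabs (Rpower (INR (S k)) (- s)) <= / INR (S k) ^ 2).
  rewrite Rabs_pos_eq; lra.
Qed.

Lemma is_series_zeta_minus_1 (s : R) :
  2 <= s -> is_series (fun k => Rpower (INR (S (S k))) (- s)) (zeta s - 1).
Proof.
  intros Hs. apply (is_series_incr_1 (fun k => Rpower (INR (S k)) (- s))).
  evar_last; [apply is_series_zeta, Hs|].
  change (zeta s = zeta s - 1 + Rpower 1 (- s)).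
  unfold Rpower. rewrite ln_1, Rmult_0_r, exp_0. ring.
Qed.

Lemma is_series_le (a b : nat -> R) (la lb : R) :
  (forall n, a n <= b n) -> is_series a la -> is_series b lb -> la <= lb.
Proof.
  intros H Ha Hb.
  apply (is_lim_seq_le (sum_n a) (sum_n b) la lb); [|exact Ha|exact Hb].
  intros n. rewrite !sum_n_psum. apply psum_le. intros i _. apply H.
Qed.

Lemma is_series_Rabs_le (a b : nat -> R) (la lb : R) :
  (forall n, Rabs (a n) <= b n) -> is_series a la -> is_series b lb -> Rabs la <= lb.
Proof.
  intros H Ha Hb. apply Rabs_le. split.
  - apply is_series_le with (fun n => - b n) a; [|exact (is_series_opp b lb Hb)|exact Ha].
    intros n. pose proof (Rabs_le_between (a n) (b n)). specialize (H n). tauto.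
  - apply is_series_le with a b; [|exact Ha|exact Hb].
    intros n. pose proof (Rabs_le_between (a n) (b n)). specialize (H n). tauto.
Qed.

Lemma is_series_Derive_zeta (s : R) :
  3 <= s ->
  is_series (fun k => ln (INR (S k)) * Rpower (INR (S k)) (- s)) (- Derive zeta s).
Proof.
  intros Hs.
  assert (Hln : forall k, 0 <= ln (INR (S k))).
  { intros k. rewrite <- ln_1. apply ln_le; [lra|].
    rewrite S_INR. pose proof (pos_INR k). lra. }
  assert (Hdom : forall k, exp ((- s + 1) * ln (INR (S k))) + exp ((- s - 1) * ln (INR (S k)))
                          <= 2 * / INR (S k) ^ 2).
  { intros k.
    pose proof (Rpower_INR_S_le k (s - 1) ltac:(lra)) as H1.
    pose proof (Rpower_INR_S_le k (s + 1) ltac:(lra)) as H2.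
    unfold Rpower in H1, H2.
    replace (- s + 1) with (- (s - 1)) by ring.
    replace (- s - 1) with (- (s + 1)) by ring. lra. }
  assert (Hex : ex_series (fun k => ln (INR (S k)) * Rpower (INR (S k)) (- s))).
  { apply (ex_series_le (K := R_AbsRing) (V := R_CompleteNormedModule) _
      (fun k => 2 * / INR (S k) ^ 2)).
    - intros k. apply Rle_trans with (1 := Rabs_mult_exp_le (- s) (ln (INR (S k)))), Hdom.
    - exact (ex_series_scal_l 2 _ ex_series_inv_sqr). }
  pose proof (Series_correct _ Hex) as Hl.
  set (l := Series _) in Hl.
  replace (- Derive zeta s) with l; [exact Hl|].
  cut (is_derive zeta s (- l)); [intros H; rewrite (is_derive_unique _ _ _ H); ring|].
  pose proof (Series_correct _ ex_series_inv_sqr) as HB.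
  set (B := Series _) in HB.
  apply is_derive_of_quadratic_error with (32 * B).
  intros h Hh. pose proof (Rabs_le_between h (/ 2)) as Hh'.
  replace (zeta (s + h) - zeta s - h * - l) with ((zeta (s + h) - zeta s) + h * l) by ring.
  apply is_series_Rabs_le with
    (fun k => (Rpower (INR (S k)) (- (s + h)) - Rpower (INR (S k)) (- s))
              + h * (ln (INR (S k)) * Rpower (INR (S k)) (- s)))
    (fun k => (32 * h ^ 2) * / INR (S k) ^ 2).
  - intros k.
    pose proof (exp_mult_taylor1 (- s) (ln (INR (S k))) (- h)) as H.
    rewrite Rabs_Ropp in H. specialize (H Hh).
    unfold Rpower.
    replace (- (s + h)) with (- s + - h) by ring.
    match type of H with Rabs ?x <= _ =>
      replace (exp ((- s + - h) * ln (INR (S k))) - exp (- s * ln (INR (S k)))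
       + h * (ln (INR (S k)) * exp (- s * ln (INR (S k))))) with x by ring end.
    apply Rle_trans with (1 := H).
    pose proof (pow2_ge_0 h). specialize (Hdom k).
    replace ((- h) ^ 2) with (h ^ 2) by ring. nra.
  - apply (is_series_plus (K := R_AbsRing) (V := R_NormedModule)).
    + apply (is_series_minus (K := R_AbsRing) (V := R_NormedModule));
        apply is_series_zeta; lra.
    + exact (is_series_scal_l h _ _ Hl).
  - replace (32 * B * h ^ 2) with ((32 * h ^ 2) * B) by ring.
    exact (is_series_scal_l (32 * h ^ 2) _ _ HB).
Qed.

Notation is_RInt_half_line f l :=
  (is_RInt_gen f (at_right 0) (Rbar_locally p_infty) l).

Lemma at_right_0_lt (d : R) : 0 < d -> at_right 0 (fun a => 0 < a < d).
Proof.
  intros Hd. exists (mkposreal d Hd). intros a Ha Ha0.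
  apply Rabs_lt_between in Ha. simpl in Ha.
  change (- d < a - 0 < d) in Ha. lra.
Qed.

Lemma half_line_filter :
  filter_prod (at_right 0) (Rbar_locally p_infty) (fun ab => 0 < fst ab <= snd ab).
Proof.
  exists (fun a => 0 < a < 1) (fun b => 1 < b).
  - apply at_right_0_lt. lra.
  - exists 1. intros b Hb. exact Hb.
  - intros a b Ha Hb. simpl. lra.
Qed.

Lemma exp_opp_half_lim : filterlim (fun t => exp (- t / 2)) (Rbar_locally p_infty) (locally 0).
Proof.
  apply filterlim_locally. intros eps.
  exists (Rmax 1 (2 * / eps)). intros t Ht.
  pose proof (Rmax_l 1 (2 * / eps)). pose proof (Rmax_r 1 (2 * / eps)).
  change (Rabs (exp (- t / 2) - 0) < eps).
  rewrite Rminus_0_r, Rabs_pos_eq by apply Rlt_le, exp_pos.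
  replace (- t / 2) with (- (t / 2)) by field.
  rewrite exp_Ropp. pose proof (exp_ineq1_le (t / 2)). pose proof (cond_pos eps).
  rewrite <- (Rinv_inv eps).
  pose proof (Rinv_0_lt_compat eps (cond_pos eps)).
  apply Rinv_lt_contravar; [apply Rmult_lt_0_compat; lra|lra].
Qed.

Lemma ex_RInt_half_line_dom (f : R -> R) (A : R) :
  (forall t, 0 < t -> continuous f t) ->
  (forall t, 0 < t -> Rabs (f t) <= A * exp (- t / 2)) ->
  ex_RInt_gen f (at_right 0) (Rbar_locally p_infty).
Proof.
  intros Hc Hf.
  set (G := fun t => -2 * A * exp (- t / 2)).
  assert (HexI : forall u v, 0 < u -> 0 < v -> ex_RInt f u v).
  { intros u v Hu Hv. apply (ex_RInt_continuous (V := R_CompleteNormedModule)).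
    intros z Hz. apply Hc.
    pose proof (Rmin_glb_lt u v 0 Hu Hv). lra. }
  assert (HG : forall u v, 0 < u -> 0 < v -> u <= v -> Rabs (RInt f u v) <= G v - G u).
  { intros u v Hu Hv Huv.
    apply (norm_RInt_le (V := R_NormedModule) f (fun t => A * exp (- t / 2)) u v); [exact Huv| | |].
    - intros t Ht. apply Hf. lra.
    - apply (RInt_correct (V := R_CompleteNormedModule)), HexI; assumption.
    - apply (is_RInt_derive (V := R_CompleteNormedModule) G (fun t => A * exp (- t / 2))).
      + intros t _. unfold G. auto_derive; [exact I|]. unfold Rdiv. field.
      + intros t _. apply (ex_derive_continuous (V := R_NormedModule)).
        auto_derive. exact I. }
  assert (HGabs : forall u v, 0 < u -> 0 < v -> Rabs (RInt f u v) <= Rabs (G v - G u)).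
  { intros u v Hu Hv. destruct (Rle_dec u v) as [Huv|Huv].
    - apply Rle_trans with (1 := HG u v Hu Hv Huv). apply Rle_abs.
    - rewrite <- (opp_RInt_swap (V := R_CompleteNormedModule)) by (apply HexI; assumption).
      change (opp ?x) with (- x). rewrite Rabs_Ropp, Rabs_minus_sym.
      apply Rle_trans with (1 := HG v u Hv Hu ltac:(lra)). apply Rle_abs. }
  assert (H : exists y : R, filterlim (fun ab : R * R => RInt f (fst ab) (snd ab))
    (filter_prod (at_right 0) (Rbar_locally p_infty)) (locally y)).
  { apply (proj1 (filterlim_locally_cauchy (U := R_CompleteSpace)
      (fun ab : R * R => RInt f (fst ab) (snd ab)))). intros eps.
    assert (He : 0 < eps / 4) by (pose proof (cond_pos eps); lra).
    assert (H0 : at_right 0 (fun a => 0 < a /\ Rabs (G a - G 0) < eps / 4)).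
    { apply filter_and.
      - apply filter_imp with (2 := at_right_0_lt 1 Rlt_0_1). intros; lra.
      - assert (Hcont : continuous G 0).
        { apply (ex_derive_continuous (V := R_NormedModule)).
          unfold G. auto_derive. exact I. }
        pose proof (proj1 (filterlim_locally _ _) Hcont (mkposreal _ He)) as Hl.
        apply filter_le_within. exact Hl. }
    assert (Hi : Rbar_locally p_infty (fun b => 0 < b /\ Rabs (G b - 0) < eps / 4)).
    { apply (filter_and (F := Rbar_locally p_infty)).
      - exists 0. auto.
      - assert (Hl : filterlim G (Rbar_locally p_infty) (locally (-2 * A * 0))).
        { apply (filterlim_comp _ _ _ (fun t => exp (- t / 2)) (fun x => -2 * A * x) _ (locally 0)).
          - exact exp_opp_half_lim.
          - apply (ex_derive_continuous (V := R_NormedModule) (fun x => -2 * A * x)).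
            auto_derive. exact I. }
        rewrite Rmult_0_r in Hl.
        exact (proj1 (filterlim_locally _ _) Hl (mkposreal _ He)). }
    exists (fun ab => (0 < fst ab /\ Rabs (G (fst ab) - G 0) < eps / 4)
                     /\ (0 < snd ab /\ Rabs (G (snd ab) - 0) < eps / 4)).
    split; [exact (Filter_prod _ _ _ _ _ H0 Hi (fun a b Ha Hb => conj Ha Hb))|].
    intros [a b] [a' b'] [[Ha1 Ha2] [Hb1 Hb2]] [[Ha1' Ha2'] [Hb1' Hb2']]. simpl in *.
    change (Rabs (RInt f a' b' - RInt f a b) < eps).
    assert (E : RInt f a' b' - RInt f a b = RInt f b b' - RInt f a a').
    { pose proof (RInt_Chasles (V := R_CompleteNormedModule) f a a' b'
        (HexI _ _ Ha1 Ha1') (HexI _ _ Ha1' Hb1')) as H1.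
      pose proof (RInt_Chasles (V := R_CompleteNormedModule) f a b b'
        (HexI _ _ Ha1 Hb1) (HexI _ _ Hb1 Hb1')) as H2.
      change (RInt f a a' + RInt f a' b' = RInt f a b') in H1.
      change (RInt f a b + RInt f b b' = RInt f a b') in H2. lra. }
    rewrite E.
    pose proof (HGabs a a' Ha1 Ha1') as H1. pose proof (HGabs b b' Hb1 Hb1') as H2.
    apply Rabs_def2 in Ha2, Hb2, Ha2', Hb2'.
    assert (Rabs (G a' - G a) < eps / 4 + eps / 4) by (apply Rabs_def1; lra).
    assert (Rabs (G b' - G b) < eps / 4 + eps / 4) by (apply Rabs_def1; lra).
    apply Rle_lt_trans with (1 := Rabs_triang _ _). rewrite Rabs_Ropp. lra. }
  destruct H as [y Hy]. exists y. apply filterlimi_locally. intros eps.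
  pose proof (proj1 (filterlim_locally _ _) Hy eps) as He.
  generalize (filter_and _ _ half_line_filter He). apply filter_imp.
  intros [a b] [[Ha Hab] Hball]. simpl in *. exists (RInt f a b). split; [|exact Hball].
  apply (RInt_correct (V := R_CompleteNormedModule)), HexI; lra.
Qed.

Lemma is_RInt_half_line_derive (F f : R -> R) (l0 l1 : R) :
  (forall t, 0 < t -> is_derive F t (f t)) ->
  (forall t, 0 < t -> continuous f t) ->
  filterlim F (at_right 0) (locally l0) ->
  filterlim F (Rbar_locally p_infty) (locally l1) ->
  is_RInt_half_line f (l1 - l0).
Proof.
  intros Hd Hc H0 H1. apply filterlimi_locally. intros eps.
  assert (Hl : filterlim (fun ab : R * R => minus (F (snd ab)) (F (fst ab)))
     (filter_prod (at_right 0) (Rbar_locally p_infty)) (locally (minus l1 l0))).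
  { apply (filterlim_comp_2 (F := filter_prod (at_right 0) (Rbar_locally p_infty))
      (fun ab => F (snd ab)) (fun ab => opp (F (fst ab))) (fun x y => plus x y)
      (G := locally l1) (H := locally (opp l0))).
    - apply filterlim_comp with (2 := H1), filterlim_snd.
    - apply (filterlim_comp _ _ _ (fun ab => F (fst ab)) opp) with (locally l0).
      + apply filterlim_comp with (2 := H0), filterlim_fst.
      + apply (filterlim_opp (V := R_NormedModule)).
    - apply (filterlim_plus (V := R_NormedModule) l1 (opp l0)). }
  pose proof (proj1 (filterlim_locally _ _) Hl eps) as He.
  generalize (filter_and _ _ half_line_filter He). apply filter_imp.
  intros [a b] [[Ha Hab] Hball]. simpl in *.
  exists (minus (F b) (F a)). split; [|exact Hball].
  apply (is_RInt_derive (V := R_CompleteNormedModule) F f); intros t Ht;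
    rewrite Rmin_left in Ht by lra; [apply Hd|apply Hc]; lra.
Qed.

Lemma exp_pow_nat (n : nat) (x : R) : exp x ^ n = exp (INR n * x).
Proof.
  induction n as [|n IH]; [simpl; now rewrite Rmult_0_l, exp_0|].
  rewrite S_INR. simpl pow. rewrite IH, <- exp_plus. f_equal. ring.
Qed.

Lemma pow_le_exp_half (n : nat) :
  exists A, 0 <= A /\ forall t, 0 < t -> t ^ n <= A * exp (t / 2).
Proof.
  set (N := 2 * INR (S n)).
  assert (HN : 0 < N) by (unfold N; rewrite S_INR; pose proof (pos_INR n); lra).
  exists (N ^ n). split; [apply pow_le; lra|]. intros t Ht.
  apply Rle_trans with ((N * exp (t / N)) ^ n).
  - apply pow_incr. split; [lra|].
    pose proof (exp_ineq1_le (t / N)) as H.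
    apply Rle_trans with (N * (1 + t / N)).
    + replace (N * (1 + t / N)) with (N + t) by (field; lra). lra.
    + apply Rmult_le_compat_l; lra.
  - rewrite Rpow_mult_distr, exp_pow_nat.
    apply Rmult_le_compat_l; [apply pow_le; lra|]. apply exp_le_mono.
    replace (INR n * (t / N)) with (t * (INR n / N)) by (field; lra).
    unfold Rdiv at 2. apply Rmult_le_compat_l; [lra|].
    apply Rmult_le_reg_r with N; [exact HN|].
    replace (INR n / N * N) with (INR n) by (field; lra).
    unfold N. rewrite S_INR. lra.
Qed.

Lemma Gamma_integrand_dom (c : R) :
  0 <= c ->
  exists A, 0 <= A /\ forall t, 0 < t -> exp (c * ln t) * exp (- t) <= A * exp (- t / 2).
Proof.
  intros Hc. destruct (INR_unbounded c) as [n Hn].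
  destruct (pow_le_exp_half n) as [A [HA H]].
  exists (A + 1). split; [lra|]. intros t Ht.
  specialize (H t Ht).
  assert (H1 : exp (c * ln t) <= 1 + t ^ n).
  { pose proof (pow_lt t n Ht).
    destruct (Rle_dec (ln t) 0) as [Hl|Hl].
    - apply Rle_trans with (exp 0); [apply exp_le_mono; nra|rewrite exp_0; lra].
    - apply Rle_trans with (exp (INR n * ln t)); [apply exp_le_mono; nra|].
      rewrite <- exp_pow_nat, exp_ln by exact Ht. lra. }
  assert (H2 : 1 <= exp (t / 2)) by (rewrite <- exp_0; apply exp_le_mono; lra).
  replace (exp (- t)) with (exp (- t / 2) * exp (- t / 2)) by (rewrite <- exp_plus; f_equal; field).
  assert (H3 : exp (t / 2) * exp (- t / 2) = 1)
    by (rewrite <- exp_plus, <- exp_0; f_equal; field).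
  pose proof (exp_pos (- t / 2)) as H4. rewrite <- Rmult_assoc.
  apply Rmult_le_compat_r; [lra|].
  apply Rle_trans with ((A + 1) * exp (t / 2) * exp (- t / 2)).
  - apply Rmult_le_compat_r; nra.
  - rewrite Rmult_assoc, H3. lra.
Qed.

Lemma Gamma_integrand_continuous (c t : R) :
  0 < t -> continuous (fun t => exp (c * ln t) * exp (- t)) t.
Proof.
  intros Ht. apply (ex_derive_continuous (V := R_NormedModule)). auto_derive. exact Ht.
Qed.

Lemma is_RInt_Gamma (x : R) :
  1 <= x -> is_RInt_half_line (fun t => exp ((x - 1) * ln t) * exp (- t)) (Gamma x).
Proof.
  intros Hx. apply (RInt_gen_correct (V := R_CompleteNormedModule)).
  destruct (Gamma_integrand_dom (x - 1) ltac:(lra)) as [A [_ HA]].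
  apply ex_RInt_half_line_dom with A.
  - intros t Ht. apply Gamma_integrand_continuous, Ht.
  - intros t Ht. rewrite Rabs_pos_eq; [apply HA, Ht|].
    apply Rlt_le, Rmult_lt_0_compat; apply exp_pos.
Qed.

Lemma filterlim_dom_0 (F : R -> R) (A : R) :
  (forall t, 0 < t -> Rabs (F t) <= A * exp (- t / 2)) ->
  filterlim F (Rbar_locally p_infty) (locally 0).
Proof.
  intros H. apply filterlim_locally. intros eps.
  assert (Hl : filterlim (fun t => A * exp (- t / 2)) (Rbar_locally p_infty) (locally (A * 0))).
  { apply (filterlim_comp _ _ _ (fun t => exp (- t / 2)) (fun x => A * x) _ (locally 0)).
    - exact exp_opp_half_lim.
    - apply (ex_derive_continuous (V := R_NormedModule) (fun x => A * x)).
      auto_derive. exact I. }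
  rewrite Rmult_0_r in Hl.
  pose proof (proj1 (filterlim_locally _ _) Hl eps) as He.
  assert (Hp : Rbar_locally p_infty (fun t => 0 < t)) by (exists 0; auto).
  generalize (filter_and _ _ Hp He). apply filter_imp. intros t [Ht Hb].
  change (Rabs (A * exp (- t / 2) - 0) < eps) in Hb.
  change (Rabs (F t - 0) < eps). rewrite Rminus_0_r in *.
  apply Rle_lt_trans with (1 := H t Ht).
  apply Rle_lt_trans with (2 := Hb). apply Rle_abs.
Qed.

Lemma Gamma_1 : Gamma 1 = 1.
Proof.
  transitivity (0 - - 1); [|ring].
  unfold Gamma. apply (is_RInt_gen_unique (V := R_CompleteNormedModule)).
  apply is_RInt_half_line_derive with (fun t => - exp (- t)).
  - intros t Ht. unfold Rpower. rewrite Rminus_diag, Rmult_0_l, exp_0.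
    auto_derive; [exact I|]. ring.
  - intros t Ht. apply Gamma_integrand_continuous, Ht.
  - replace (- 1) with (- exp (- 0)) by (rewrite Ropp_0, exp_0; reflexivity).
    assert (Hc : continuous (fun t => - exp (- t)) 0).
    { apply (ex_derive_continuous (V := R_NormedModule)). auto_derive. exact I. }
    apply filterlim_filter_le_1 with (2 := Hc). apply filter_le_within.
  - apply filterlim_dom_0 with 1. intros t Ht.
    rewrite Rabs_Ropp, Rabs_pos_eq by apply Rlt_le, exp_pos.
    rewrite Rmult_1_l. apply exp_le_mono. lra.
Qed.

Lemma Gamma_succ (x : R) : 1 <= x -> Gamma (x + 1) = x * Gamma x.
Proof.
  intros Hx.
  pose proof (is_RInt_Gamma (x + 1) ltac:(lra)) as H1.
  pose proof (is_RInt_gen_scal (V := R_NormedModule) _ x _ (is_RInt_Gamma x Hx)) as H2.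
  pose proof (is_RInt_gen_minus (V := R_NormedModule) _ _ _ _ H1 H2) as H3.
  pose proof (is_RInt_gen_unique (V := R_CompleteNormedModule) _ _ H3) as H4.
  change (minus (Gamma (x + 1)) (scal x (Gamma x))) with (Gamma (x + 1) - x * Gamma x) in H4.
  cut (Gamma (x + 1) - x * Gamma x = 0 - 0); [lra|]. rewrite <- H4.
  apply (is_RInt_gen_unique (V := R_CompleteNormedModule)).
  destruct (Gamma_integrand_dom x ltac:(lra)) as [A [_ HA]].
  apply is_RInt_half_line_derive with (fun t => - (exp (x * ln t) * exp (- t))).
  - intros t Ht.
    change (is_derive (fun t => - (exp (x * ln t) * exp (- t))) t
      (exp ((x + 1 - 1) * ln t) * exp (- t) - x * (exp ((x - 1) * ln t) * exp (- t)))).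
    auto_derive; [exact Ht|].
    replace ((x + 1 - 1) * ln t) with (x * ln t) by ring.
    replace (x * ln t) with ((x - 1) * ln t + ln t) by ring.
    rewrite exp_plus, exp_ln by exact Ht. field. lra.
  - intros t Ht. apply (continuous_minus (V := R_NormedModule));
      [apply Gamma_integrand_continuous, Ht|].
    apply (continuous_scal_r (V := R_NormedModule)). apply Gamma_integrand_continuous, Ht.
  - apply filterlim_locally. intros eps.
    assert (He : 0 < Rmin 1 eps) by (apply Rmin_pos; [lra|apply cond_pos]).
    apply filter_imp with (2 := at_right_0_lt _ He). intros t Ht.
    pose proof (Rmin_l 1 eps). pose proof (Rmin_r 1 eps).
    change (Rabs (- (exp (x * ln t) * exp (- t)) - 0) < eps).
    rewrite Rminus_0_r, Rabs_Ropp, Rabs_pos_eq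
      by (apply Rlt_le, Rmult_lt_0_compat; apply exp_pos).
    assert (Hl : ln t < 0) by (rewrite <- ln_1; apply ln_increasing; lra).
    apply Rle_lt_trans with (t * 1); [|lra].
    apply Rmult_le_compat; try (apply Rlt_le, exp_pos).
    + rewrite <- (exp_ln t) at 2 by lra. apply exp_le_mono. nra.
    + rewrite <- exp_0. apply exp_le_mono. lra.
  - apply filterlim_dom_0 with A. intros t Ht.
    rewrite Rabs_Ropp, Rabs_pos_eq; [apply HA, Ht|].
    apply Rlt_le, Rmult_lt_0_compat; apply exp_pos.
Qed.

Lemma Gamma_INR_S (n : nat) : Gamma (INR (S n)) = INR (fact n).
Proof.
  induction n as [|n IH]; [exact Gamma_1|].
  rewrite (S_INR (S n)), Gamma_succ, IH by (rewrite S_INR; pose proof (pos_INR n); lra).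
  change (fact (S n)) with (S n * fact n)%nat. now rewrite mult_INR.
Qed.

Lemma ex_derive_Gamma (x : R) : 2 <= x -> ex_derive Gamma x.
Proof.
  intros Hx.
  assert (HM : is_RInt_half_line
    (fun t => (exp ((x + 1 - 1) * ln t) * exp (- t) + exp ((x - 1 - 1) * ln t) * exp (- t)))
    (Gamma (x + 1) + Gamma (x - 1))).
  { apply (is_RInt_gen_plus (V := R_NormedModule)); apply is_RInt_Gamma; lra. }
  assert (Hex : ex_RInt_gen (fun t => ln t * exp ((x - 1) * ln t) * exp (- t))
    (at_right 0) (Rbar_locally p_infty)).
  { destruct (Gamma_integrand_dom (x - 1 + 1) ltac:(lra)) as [A1 [_ HA1]].
    destruct (Gamma_integrand_dom (x - 1 - 1) ltac:(lra)) as [A2 [_ HA2]].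
    apply ex_RInt_half_line_dom with (A1 + A2).
    - intros t Ht. apply (ex_derive_continuous (V := R_NormedModule)).
      auto_derive. auto.
    - intros t Ht. specialize (HA1 t Ht). specialize (HA2 t Ht).
      rewrite Rabs_mult, (Rabs_pos_eq (exp (- t))) by apply Rlt_le, exp_pos.
      pose proof (Rabs_mult_exp_le (x - 1) (ln t)). pose proof (exp_pos (- t)). nra. }
  destruct Hex as [l Hl]. exists l.
  apply is_derive_of_quadratic_error with (16 * (Gamma (x + 1) + Gamma (x - 1))).
  intros h Hh. pose proof (proj1 (Rabs_le_between h (/ 2)) Hh) as Hh'.
  pose proof (is_RInt_Gamma (x + h) ltac:(lra)) as H1.
  pose proof (is_RInt_Gamma x ltac:(lra)) as H2.
  pose proof (is_RInt_gen_minus (V := R_NormedModule) _ _ _ _ H1 H2) as H3.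
  pose proof (is_RInt_gen_scal (V := R_NormedModule) _ h _ Hl) as H4.
  pose proof (is_RInt_gen_minus (V := R_NormedModule) _ _ _ _ H3 H4) as H5.
  pose proof (is_RInt_gen_scal (V := R_NormedModule) _ (16 * h ^ 2) _ HM) as H6.
  replace (16 * (Gamma (x + 1) + Gamma (x - 1)) * h ^ 2)
    with (16 * h ^ 2 * (Gamma (x + 1) + Gamma (x - 1))) by ring.
  apply (RInt_gen_norm (V := R_CompleteNormedModule)) with (4 := H6) (3 := H5).
  - apply filter_imp with (2 := half_line_filter). intros; lra.
  - apply filter_imp with (2 := half_line_filter). intros [a b] Hab t Ht. simpl in Hab, Ht.
    change (Rabs (exp ((x + h - 1) * ln t) * exp (- t) - exp ((x - 1) * ln t) * exp (- t)
      - h * (ln t * exp ((x - 1) * ln t) * exp (- t)))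
      <= 16 * h ^ 2 * (exp ((x + 1 - 1) * ln t) * exp (- t)
                       + exp ((x - 1 - 1) * ln t) * exp (- t))).
    pose proof (exp_mult_taylor1 (x - 1) (ln t) h Hh) as H.
    replace (x + h - 1) with (x - 1 + h) by ring.
    replace (x + 1 - 1) with (x - 1 + 1) by ring.
    match type of H with Rabs ?y <= ?z =>
      match goal with |- Rabs ?u <= ?v =>
        replace u with (y * exp (- t)) by ring;
        replace v with (z * exp (- t)) by ring end end.
    rewrite Rabs_mult, (Rabs_pos_eq (exp (- t))) by apply Rlt_le, exp_pos.
    apply Rmult_le_compat_r; [apply Rlt_le, exp_pos|exact H].
Qed.

Lemma digamma_succ (x : R) :
  2 <= x -> Gamma x <> 0 -> digamma (x + 1) = digamma x + / x.
Proof.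
  intros Hx H0. unfold digamma.
  assert (HD : Derive Gamma (x + 1) = Gamma x + x * Derive Gamma x).
  { transitivity (Derive (fun y => Gamma (y + 1)) x).
    - symmetry. apply is_derive_unique. evar_last.
      + apply (is_derive_comp Gamma (fun y => y + 1) x).
        * apply Derive_correct, ex_derive_Gamma. lra.
        * auto_derive; [exact I|reflexivity].
      + apply Rmult_1_l.
    - rewrite (Derive_ext_loc (fun y => Gamma (y + 1)) (fun y => y * Gamma y)).
      + rewrite Derive_mult;
          [rewrite Derive_id; ring|apply ex_derive_id|apply ex_derive_Gamma; exact Hx].
      + exists (mkposreal 1 Rlt_0_1). intros y Hy. apply Gamma_succ.
        apply Rabs_lt_between in Hy. simpl in Hy. change (-1 < y - x < 1) in Hy. lra. }
  rewrite HD, Gamma_succ by lra. field. lra.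
Qed.

Lemma digamma_INR_add (p k : nat) :
  (1 <= p)%nat ->
  digamma (INR (S p + k)) = digamma (INR (S p)) + psum (fun i => / INR (p + S i)) k.
Proof.
  intros Hp. induction k as [|k IH].
  - rewrite Nat.add_0_r. simpl psum. ring.
  - replace (S p + S k)%nat with (S (S p + k)) by lia.
    rewrite (S_INR (S p + k)), digamma_succ, IH.
    + simpl psum. replace (p + S k)%nat with (S p + k)%nat by lia. ring.
    + apply (le_INR 2). lia.
    + change (S p + k)%nat with (S (p + k)). rewrite Gamma_INR_S. apply INR_fact_neq_0.
Qed.

Lemma psum_rev (f : nat -> R) (n : nat) :
  psum (fun k => f (n - k)%nat) (S n) = psum f (S n).
Proof.
  induction n as [|n IH]; [reflexivity|].
  rewrite psum_shift, Nat.sub_0_r.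
  change (psum (fun k => f (n - k)%nat) (S n)) with (psum (fun i => f (S n - S i)%nat) (S n)) in IH.
  rewrite IH. simpl. ring.
Qed.

Lemma is_series_tail_le (a M : nat -> R) (la lM : R) (n : nat) :
  (forall k, Rabs (a k) <= M k) -> is_series a la -> is_series M lM ->
  Rabs (la - sum_n a n) <= lM - sum_n M n.
Proof.
  intros H Ha HM.
  apply is_series_Rabs_le with (fun k => a (S n + k)%nat) (fun k => M (S n + k)%nat).
  - intros k. apply H.
  - apply (is_series_incr_n (K := R_AbsRing) (V := R_NormedModule) a (S n)); [lia|].
    evar_last; [exact Ha|]. change (la = la - sum_n a n + sum_n a n). ring.
  - apply (is_series_incr_n (K := R_AbsRing) (V := R_NormedModule) M (S n)); [lia|].
    evar_last; [exact HM|]. change (lM = lM - sum_n M n + sum_n M n). ring.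
Qed.

(* [filterlim_RInt] asks for uniform convergence on the whole line, hence the clamping. *)
Lemma is_RInt_series (f : nat -> R -> R) (g : R -> R) (J M : nat -> R) (a b : R) :
  a <= b ->
  (forall n, is_RInt (f n) a b (J n)) ->
  (forall n x, a <= x <= b -> Rabs (f n x) <= M n) ->
  ex_series M ->
  (forall x, a <= x <= b -> is_series (fun n => f n x) (g x)) ->
  exists l : R, is_series J l /\ is_RInt g a b l.
Proof.
  intros Hab HJ HM [lM HlM] Hg.
  set (cl := fun x => Rmax a (Rmin x b)).
  assert (Hcl : forall x, a <= cl x <= b).
  { intros x. unfold cl. split; [apply Rmax_l|].
    apply Rmax_lub; [exact Hab|apply Rmin_r]. }
  assert (Hid : forall x, Rmin a b < x < Rmax a b -> cl x = x).
  { intros x. rewrite Rmin_left, Rmax_right by exact Hab. intros Hx. unfold cl.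
    rewrite Rmin_left by lra. rewrite Rmax_right by lra. reflexivity. }
  destruct (filterlim_RInt (V := R_CompleteNormedModule)
    (fun n x => sum_n (fun k => f k (cl x)) n) a b eventually eventually_filter
    (fun x => g (cl x)) (sum_n J)) as [l [Hl1 Hl2]].
  - intros n. rewrite sum_n_psum.
    apply is_RInt_ext with (fun x => psum (fun k => f k x) (S n)).
    + intros x Hx. rewrite Hid by exact Hx. symmetry. apply sum_n_psum.
    + apply is_RInt_psum. auto.
  - apply (proj2 (filterlim_locally (U := fct_UniformSpace R R_UniformSpace) _ _)).
    intros eps.
    pose proof (proj1 (filterlim_locally _ _) HlM eps) as He.
    apply filter_imp with (2 := He). intros n Hn x.
    change (Rabs (sum_n M n - lM) < eps) in Hn.
    change (Rabs (sum_n (fun k => f k (cl x)) n - g (cl x)) < eps).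
    rewrite Rabs_minus_sym in *.
    apply Rle_lt_trans with (2 := Hn). apply Rle_trans with (2 := Rle_abs _).
    apply is_series_tail_le; auto.
  - exists l. split; [exact Hl1|].
    apply is_RInt_ext with (2 := Hl2). intros x Hx. now rewrite Hid.
Qed.

Lemma Rpower_opp_INR (x : R) (n : nat) : 0 < x -> Rpower x (- INR n) = / x ^ n.
Proof. intros Hx. now rewrite Rpower_Ropp, Rpower_pow. Qed.

Lemma is_RInt_beta_cell (p k l : nat) :
  is_RInt (fun x => / (INR (S k) + x) ^ S p * / (INR (S l) + (1 - x)) ^ S p) 0 1
    (/ INR (S (S (S (k + l)))) ^ S (p + p)
     * (beta_prim p (INR (S (S k)) / INR (S (S (S (k + l)))))
        - beta_prim p (INR (S k) / INR (S (S (S (k + l))))))).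
Proof.
  set (N := INR (S (S (S (k + l))))).
  assert (HN : N = INR (S k) + INR (S l) + 1).
  { unfold N. rewrite <- plus_INR, <- S_INR. f_equal. lia. }
  assert (Hk : 0 < INR (S k)) by (apply lt_0_INR; lia).
  assert (Hl : 0 < INR (S l)) by (apply lt_0_INR; lia).
  evar_last.
  - apply (is_RInt_derive (V := R_CompleteNormedModule)
      (fun x => / N ^ S (p + p) * beta_prim p ((INR (S k) + x) / N))).
    + rewrite Rmin_left, Rmax_right by lra. intros x Hx.
      assert (Hu : 0 < (INR (S k) + x) / N < 1).
      { split; [apply Rdiv_lt_0_compat; lra|].
        apply Rmult_lt_reg_r with N; [lra|].
        unfold Rdiv. rewrite Rmult_assoc, Rinv_l; lra. }
      evar_last.
      * apply is_derive_scal.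
        apply (is_derive_comp (beta_prim p) (fun x => (INR (S k) + x) / N) x).
        -- apply is_derive_beta_prim, Hu.
        -- assert (N <> 0) by lra.
           instantiate (1 := / N). auto_derive; [exact I|]. field. lra.
      * change (/ N ^ S (p + p)
          * (/ N * / (((INR (S k) + x) / N) ^ S p * (1 - (INR (S k) + x) / N) ^ S p))
          = / (INR (S k) + x) ^ S p * / (INR (S l) + (1 - x)) ^ S p).
        replace (1 - (INR (S k) + x) / N) with ((INR (S l) + (1 - x)) / N)
          by (rewrite HN; field; lra).
        unfold Rdiv. rewrite !Rpow_mult_distr, !pow_inv.
        replace (N ^ S (p + p)) with (N ^ S p * N ^ p) by (rewrite <- pow_add; reflexivity).
        simpl (N ^ S p).
        assert (N ^ p <> 0) by (apply pow_nonzero; lra).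
        assert ((INR (S k) + x) ^ S p <> 0) by (apply pow_nonzero; lra).
        assert ((INR (S l) + (1 - x)) ^ S p <> 0) by (apply pow_nonzero; lra).
        field. repeat split; auto; lra.
    + rewrite Rmin_left, Rmax_right by lra. intros x Hx.
      apply (ex_derive_continuous (V := R_NormedModule)).
      set (u := INR (S k)) in *. set (v := INR (S l)) in *.
      auto_derive. split; [apply (pow_nonzero (u + x) (S p)); lra|].
      split; [apply (pow_nonzero (v + (1 - x)) (S p)); lra|exact I].
  - change (/ N ^ S (p + p) * beta_prim p ((INR (S k) + 1) / N)
      - / N ^ S (p + p) * beta_prim p ((INR (S k) + 0) / N)
      = / N ^ S (p + p) * (beta_prim p (INR (S (S k)) / N) - beta_prim p (INR (S k) / N))).
    rewrite Rplus_0_r, <- (S_INR (S k)). ring.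
Qed.

Lemma beta_cell_le (p : nat) (u v a b : R) :
  (1 <= p)%nat -> 1 <= a <= u -> 1 <= b <= v ->
  0 <= / u ^ S p * / v ^ S p <= 2 * / (u + v) ^ 2 * (/ a ^ 2 + / b ^ 2).
Proof.
  intros Hp Ha Hb.
  assert (H1 : forall y, 1 <= y -> 0 < / y ^ S p <= / y ^ 2).
  { intros y Hy. split; [apply Rinv_0_lt_compat, pow_lt; lra|].
    apply Rinv_le_contravar; [apply pow_lt; lra|]. apply Rle_pow; [lra|lia]. }
  assert (H2 : forall y z, 1 <= y <= z -> 0 < / z ^ 2 <= / y ^ 2).
  { intros y z Hy. split; [apply Rinv_0_lt_compat, pow_lt; lra|].
    apply Rinv_le_contravar; [apply pow_lt; lra|]. apply pow_incr. lra. }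
  pose proof (H1 u ltac:(lra)) as Hu. pose proof (H1 v ltac:(lra)) as Hv.
  pose proof (H2 a u Ha) as Hau. pose proof (H2 b v Hb) as Hbv.
  split; [apply Rmult_le_pos; lra|].
  apply Rle_trans with (/ u ^ 2 * / v ^ 2); [apply Rmult_le_compat; lra|].
  assert (Hs : 0 < / (u + v) ^ 2) by (apply Rinv_0_lt_compat, pow_lt; lra).
  apply Rle_trans with (2 * / (u + v) ^ 2 * (/ u ^ 2 + / v ^ 2)).
  - replace (/ u ^ 2 * / v ^ 2)
      with (/ (u + v) ^ 2 * (/ u ^ 2 + / v ^ 2 + 2 * (/ u * / v))) by (field; lra).
    replace (2 * / (u + v) ^ 2 * (/ u ^ 2 + / v ^ 2))
      with (/ (u + v) ^ 2 * (2 * (/ u ^ 2 + / v ^ 2))) by ring.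
    apply Rmult_le_compat_l; [lra|]. rewrite <- !pow_inv.
    pose proof (pow2_ge_0 (/ u - / v)). lra.
  - apply Rmult_le_compat_l; lra.
Qed.

Lemma is_series_zeta1 (q : nat) (x : R) :
  (2 <= q)%nat -> 0 <= x ->
  is_series (fun k => Rpower (INR (S k) + x) (- INR q)) (zeta1 (INR q) x).
Proof.
  intros Hq Hx. apply Series_correct.
  apply (ex_series_le (K := R_AbsRing) (V := R_CompleteNormedModule) _
    (fun k => / INR (S k) ^ 2)); [|exact ex_series_inv_sqr].
  intros k. change (Rabs (Rpower (INR (S k) + x) (- INR q)) <= / INR (S k) ^ 2).
  assert (Hk : 1 <= INR (S k)) by (rewrite S_INR; pose proof (pos_INR k); lra).
  rewrite Rpower_opp_INR by lra.
  rewrite Rabs_pos_eq by (apply Rlt_le, Rinv_0_lt_compat, pow_lt; lra).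
  apply Rinv_le_contravar; [apply pow_lt; lra|].
  apply Rle_trans with ((INR (S k) + x) ^ 2); [apply pow_incr; lra|apply Rle_pow; [lra|lia]].
Qed.

(* Along the antidiagonal [k + l = n] of the Cauchy product the cells tile [1, n + 2],
   so their integrals telescope. *)
Lemma RInt_zeta1_product (p : nat) :
  (1 <= p)%nat ->
  exists l : R,
    is_RInt (fun x => zeta1 (INR (S p)) x * zeta1 (INR (S p)) (1 - x)) 0 1 l
    /\ is_series (fun k => - 2 * (/ INR (S (S k)) ^ S (p + p)
                                  * beta_prim p (/ INR (S (S k))))) l.
Proof.
  intros Hp.
  set (c := fun k l x => / (INR (S k) + x) ^ S p * / (INR (S l) + (1 - x)) ^ S p).
  set (N := fun n => INR (S (S n))).
  set (B := Series (fun k => / INR (S k) ^ 2)).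
  pose proof (Series_correct _ ex_series_inv_sqr) as HB. fold B in HB.
  destruct (is_RInt_series
    (fun n x => psum (fun k => c k (n - k)%nat x) (S n))
    (fun x => zeta1 (INR (S p)) x * zeta1 (INR (S p)) (1 - x))
    (fun n => - 2 * (/ N (S n) ^ S (p + p) * beta_prim p (/ N (S n))))
    (fun n => 4 * B * / INR (S n) ^ 2) 0 1) as [l [Hl1 Hl2]]; [lra| | | | |].
  - intros n.
    assert (HN : 0 < N (S n)) by (apply lt_0_INR; lia).
    evar_last.
    + apply is_RInt_psum. intros k Hk. apply is_RInt_beta_cell.
    + rewrite (psum_ext _ (fun k => / N (S n) ^ S (p + p)
        * (beta_prim p (INR (S (S k)) / N (S n)) - beta_prim p (INR (S k) / N (S n))))).
      * rewrite psum_scal,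
          (psum_telescope (fun k => beta_prim p (INR (S k) / N (S n)))).
        replace (INR (S (S n)) / N (S n)) with (1 - / N (S n))
          by (unfold N in *; rewrite (S_INR (S (S n))) in *; field; lra).
        rewrite beta_prim_opp.
        replace (INR 1 / N (S n)) with (/ N (S n)) by (simpl (INR 1); field; lra). ring.
      * intros k Hk. unfold N. replace (k + (n - k))%nat with n by lia. reflexivity.
  - intros n x Hx.
    assert (HS : forall k, 1 <= INR (S k)) by (intros k; rewrite S_INR; pose proof (pos_INR k); lra).
    assert (Hc : forall k, (k < S n)%nat -> 0 <= c k (n - k)%nat x
       <= 2 * / INR (S n) ^ 2 * (/ INR (S k) ^ 2 + / INR (S (n - k)) ^ 2)).
    { intros k Hk.
      pose proof (HS k). pose proof (HS (n - k)%nat). pose proof (HS n).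
      pose proof (beta_cell_le p (INR (S k) + x) (INR (S (n - k)) + (1 - x))
        (INR (S k)) (INR (S (n - k))) Hp ltac:(lra) ltac:(lra)) as H2.
      split; [apply H2|]. apply Rle_trans with (1 := proj2 H2).
      assert (0 < / INR (S k) ^ 2) by (apply Rinv_0_lt_compat, pow_lt; lra).
      assert (0 < / INR (S (n - k)) ^ 2) by (apply Rinv_0_lt_compat, pow_lt; lra).
      apply Rmult_le_compat_r; [lra|]. apply Rmult_le_compat_l; [lra|].
      apply Rinv_le_contravar; [apply pow_lt; lra|]. apply pow_incr.
      split; [lra|].
      assert (INR (S k) + INR (S (n - k)) = INR (S n) + 1)
        by (rewrite <- plus_INR, <- S_INR; f_equal; lia). lra. }
    rewrite Rabs_pos_eq by (apply psum_nonneg; intros k Hk; apply Hc; exact Hk).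
    apply Rle_trans with (psum (fun k =>
      2 * / INR (S n) ^ 2 * (/ INR (S k) ^ 2 + / INR (S (n - k)) ^ 2)) (S n)).
    + apply psum_le. intros k Hk. apply Hc, Hk.
    + rewrite psum_scal, psum_plus, (psum_rev (fun k => / INR (S k) ^ 2)).
      assert (HBn : psum (fun k => / INR (S k) ^ 2) (S n) <= B).
      { rewrite <- sum_n_psum.
        apply (is_lim_seq_incr_compare (sum_n (fun k => / INR (S k) ^ 2)) B).
        - exact HB.
        - intros k. rewrite sum_Sn.
          assert (0 < / INR (S (S k)) ^ 2)
            by (apply Rinv_0_lt_compat, pow_lt, lt_0_INR; lia).
          change (sum_n (fun k => / INR (S k) ^ 2) k
            <= sum_n (fun k => / INR (S k) ^ 2) k + / INR (S (S k)) ^ 2). lra. }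
      assert (0 < / INR (S n) ^ 2) by (apply Rinv_0_lt_compat, pow_lt, lt_0_INR; lia).
      nra.
  - exact (ex_series_scal_l (4 * B) _ ex_series_inv_sqr).
  - intros x Hx.
    apply is_series_ext with (2 := is_series_mult_pos _ _ _ _
      (is_series_zeta1 (S p) x ltac:(lia) ltac:(lra))
      (is_series_zeta1 (S p) (1 - x) ltac:(lia) ltac:(lra))
      (fun n => Rlt_le _ _ (exp_pos _)) (fun n => Rlt_le _ _ (exp_pos _))).
    intros n. rewrite <- sum_n_Reals, sum_n_psum. apply psum_ext. intros k _. unfold c.
    assert (HS : forall k, 0 < INR (S k)) by (intros j; apply lt_0_INR; lia).
    pose proof (HS k). pose proof (HS (n - k)%nat).
    rewrite !Rpower_opp_INR by lra. reflexivity.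
  - exists l. split; [exact Hl2|].
    apply (is_series_decr_1 (K := R_AbsRing) (V := R_NormedModule)).
    evar_last; [exact Hl1|].
    assert (H0 : beta_prim p (/ INR 2) = 0).
    { pose proof (beta_prim_opp p (/ INR 2)) as H.
      replace (1 - / INR 2) with (/ INR 2) in H by (simpl; field). lra. }
    rewrite H0. change (l = l + - (-2 * (/ INR 2 ^ S (p + p) * 0))). ring.
Qed.

Lemma is_series_inv_pow_zeta (q : nat) :
  (2 <= q)%nat -> is_series (fun k => / INR (S (S k)) ^ q) (zeta (INR q) - 1).
Proof.
  intros Hq. apply is_series_ext with (fun k => Rpower (INR (S (S k))) (- INR q)).
  - intros k. apply Rpower_opp_INR, lt_0_INR. lia.
  - apply is_series_zeta_minus_1. apply (le_INR 2). exact Hq.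
Qed.

Lemma is_series_ln_Derive_zeta (q : nat) :
  (3 <= q)%nat ->
  is_series (fun k => / INR (S (S k)) ^ q * ln (INR (S (S k)))) (- Derive zeta (INR q)).
Proof.
  intros Hq.
  apply is_series_ext with (fun k => ln (INR (S (S k))) * Rpower (INR (S (S k))) (- INR q)).
  - intros k. rewrite Rpower_opp_INR by (apply lt_0_INR; lia). apply Rmult_comm.
  - apply (is_series_incr_1 (fun k => ln (INR (S k)) * Rpower (INR (S k)) (- INR q))).
    evar_last.
    + apply is_series_Derive_zeta. apply (le_INR 3) in Hq. simpl in Hq. lra.
    + change (- Derive zeta (INR q)
        = - Derive zeta (INR q) + ln 1 * Rpower 1 (- INR q)).
      rewrite ln_1. ring.
Qed.

Lemma summand_lt (p n : nat) :
  (n < p)%nat ->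
  summand (S p) n = - (Binomial.C (p + n) n / INR (p - n) * (zeta (INR (S p + n)) - 1)).
Proof.
  intros Hn. unfold summand. destruct (Nat.eq_dec n (S p - 1)) as [E|_]; [lia|].
  rewrite binomial_pochhammer.
  replace (INR n + INR (S p)) with (INR (S p + n)) by (rewrite plus_INR; ring).
  assert (H : 0 < INR (p - n)) by (apply lt_0_INR; lia).
  rewrite minus_INR in * by lia. rewrite (S_INR p). field. lra.
Qed.

Lemma summand_gt (p j : nat) :
  summand (S p) (S p + j)
  = Binomial.C (p + (S p + j)) (S p + j) / INR (S j) * (zeta (INR (S (p + p) + S j)) - 1).
Proof.
  unfold summand. destruct (Nat.eq_dec (S p + j) (S p - 1)) as [E|_]; [lia|].
  rewrite binomial_pochhammer.
  replace (INR (S p + j) + INR (S p)) with (INR (S (p + p) + S j))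
    by (rewrite <- plus_INR; f_equal; lia).
  replace (INR (S p + j) + 1 - INR (S p)) with (INR (S j)).
  - unfold Rdiv. ring.
  - rewrite plus_INR, !S_INR. ring.
Qed.

Lemma psum_summand (p K : nat) :
  psum (summand (S p)) (S p + K)
  = psum (fun i => - (Binomial.C (p + i) i / INR (p - i) * (zeta (INR (S p + i)) - 1))) p
    + psum (fun j => Binomial.C (p + (S p + j)) (S p + j) / INR (S j)
                     * (zeta (INR (S (p + p) + S j)) - 1)) K.
Proof.
  rewrite psum_add.
  change (psum ?f (S p)) with (psum f p + f p). cbv beta.
  replace (summand (S p) p) with 0.
  - rewrite Rplus_0_r. f_equal; apply psum_ext; intros i Hi;
      [apply summand_lt, Hi|apply summand_gt].
  - unfold summand. destruct (Nat.eq_dec p (S p - 1)) as [_|E]; [reflexivity|lia].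
Qed.

(* The sum over [k] and the sum over [n] are exchanged at each truncation [K] of the latter,
   where it is finite; the remainder is uniformly small in [k]. *)
Lemma is_series_summand (p : nat) (l : R) :
  (1 <= p)%nat ->
  is_series (fun k => - 2 * (/ INR (S (S k)) ^ S (p + p)
                             * beta_prim p (/ INR (S (S k))))) l ->
  is_series (summand (S p))
    (- (l / 2
        + psum (fun i => Binomial.C (p + i) i / INR (p - i)) p
          * (zeta (INR (S (p + p))) - 1)
        + Binomial.C (p + p) p * Derive zeta (INR (S (p + p))))).
Proof.
  intros Hp Hl.
  set (Hs := psum (fun i => Binomial.C (p + i) i / INR (p - i)) p).
  set (Z := zeta (INR (S (p + p))) - 1).
  set (L := l / 2 + Hs * Z + Binomial.C (p + p) p * Derive zeta (INR (S (p + p)))).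
  destruct (beta_reg_remainder p) as [A [HA0 HA]].
  assert (Hq : (3 <= S (p + p))%nat) by lia.
  pose proof (is_series_inv_pow_zeta (S (p + p)) ltac:(lia)) as HZ. fold Z in HZ.
  assert (Hbound : forall K,
    Rabs (- L - psum (summand (S p)) (S p + K)) <= A * Z * (2 / 3) ^ K).
  { intros K.
    assert (Hser : is_series (fun k =>
        - / 2 * (- 2 * (/ INR (S (S k)) ^ S (p + p) * beta_prim p (/ INR (S (S k)))))
        + - (psum (fun i => - (Binomial.C (p + i) i / INR (p - i))
                            * / INR (S (S k)) ^ (S p + i)) p
             + psum (fun j => Binomial.C (p + (S p + j)) (S p + j) / INR (S j)
                            * / INR (S (S k)) ^ (S (p + p) + S j)) K)
        + - Hs * / INR (S (S k)) ^ S (p + p)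
        + Binomial.C (p + p) p * (/ INR (S (S k)) ^ S (p + p) * ln (INR (S (S k)))))
      (- / 2 * l
       + - (psum (fun i => - (Binomial.C (p + i) i / INR (p - i))
                           * (zeta (INR (S p + i)) - 1)) p
            + psum (fun j => Binomial.C (p + (S p + j)) (S p + j) / INR (S j)
                           * (zeta (INR (S (p + p) + S j)) - 1)) K)
       + - Hs * Z + Binomial.C (p + p) p * - Derive zeta (INR (S (p + p))))).
    { repeat apply (is_series_plus (K := R_AbsRing) (V := R_NormedModule)).
      - exact (is_series_scal_l (- / 2) _ _ Hl).
      - apply (is_series_opp (K := R_AbsRing) (V := R_NormedModule)).
        apply (is_series_plus (K := R_AbsRing) (V := R_NormedModule)); apply is_series_psum;
          intros i Hi;
          refine (is_series_scal_l _ _ _ (is_series_inv_pow_zeta _ _)); lia.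
      - exact (is_series_scal_l (- Hs) _ _ HZ).
      - exact (is_series_scal_l (Binomial.C (p + p) p) _ _ (is_series_ln_Derive_zeta _ Hq)). }
    replace (- L - psum (summand (S p)) (S p + K)) with
      (- / 2 * l
       + - (psum (fun i => - (Binomial.C (p + i) i / INR (p - i))
                           * (zeta (INR (S p + i)) - 1)) p
            + psum (fun j => Binomial.C (p + (S p + j)) (S p + j) / INR (S j)
                           * (zeta (INR (S (p + p) + S j)) - 1)) K)
       + - Hs * Z + Binomial.C (p + p) p * - Derive zeta (INR (S (p + p)))).
    2: { rewrite psum_summand. unfold L.
         rewrite (psum_ext (fun i => - (Binomial.C (p + i) i / INR (p - i))
                           * (zeta (INR (S p + i)) - 1))
           (fun i => - (Binomial.C (p + i) i / INR (p - i) * (zeta (INR (S p + i)) - 1))))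
           by (intros; ring).
         field. }
    replace (A * Z * (2 / 3) ^ K) with (A * (2 / 3) ^ K * Z) by ring.
    apply is_series_Rabs_le with (2 := Hser)
      (b := fun k => A * (2 / 3) ^ K * / INR (S (S k)) ^ S (p + p));
      [|exact (is_series_scal_l (A * (2 / 3) ^ K) _ _ HZ)].
    intros k. set (N := INR (S (S k))).
    assert (HN : 2 <= N) by (apply (le_INR 2); lia).
    assert (Ht : 0 < / N <= / 2).
    { split; [apply Rinv_0_lt_compat; lra|apply Rinv_le_contravar; lra]. }
    assert (HNp : forall i, N ^ i <> 0) by (intros i; apply pow_nonzero; lra).
    specialize (HA K (/ N) Ht).
    match goal with |- Rabs ?x <= _ =>
      replace x with ((beta_reg p (/ N) - beta_trunc p K (/ N)) * / N ^ S (p + p)) end.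
    - assert (0 < / N ^ S (p + p)) by (apply Rinv_0_lt_compat, pow_lt; lra).
      rewrite Rabs_pos_eq by (apply Rmult_le_pos; lra).
      apply Rmult_le_compat_r; lra.
    - rewrite beta_prim_reg. fold Hs.
      rewrite ln_Rinv by lra.
      replace (psum (fun i => - (Binomial.C (p + i) i / INR (p - i)) * / N ^ (S p + i)) p)
        with (- / N ^ S (p + p)
          * psum (fun i => Binomial.C (p + i) i / INR (p - i) * / (/ N) ^ (p - i)) p).
      + replace (psum (fun j => Binomial.C (p + (S p + j)) (S p + j) / INR (S j)
                            * / N ^ (S (p + p) + S j)) K)
          with (/ N ^ S (p + p) * beta_trunc p K (/ N)); [field; auto|].
        unfold beta_trunc. rewrite <- psum_scal. apply psum_ext. intros j _.
        rewrite pow_inv, pow_add, Rinv_mult. ring.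
      + rewrite <- psum_scal. apply psum_ext. intros i Hi.
        rewrite pow_inv, Rinv_inv.
        replace (S (p + p)) with ((S p + i) + (p - i))%nat by lia.
        rewrite pow_add, Rinv_mult.
        transitivity (- / N ^ (S p + i) * (Binomial.C (p + i) i / INR (p - i))
          * (/ N ^ (p - i) * N ^ (p - i))); [ring|].
        rewrite Rinv_l by auto. ring. }
  apply (is_lim_seq_incr_n (sum_n (summand (S p))) p (- L)).
  apply (is_lim_seq_ext (fun K => psum (summand (S p)) (S p + K))).
  { intros K. rewrite sum_n_psum. f_equal. lia. }
  assert (Hgeom : is_lim_seq (fun K => A * Z * (2 / 3) ^ K) 0).
  { evar_last.
    - apply is_lim_seq_scal_l, is_lim_seq_geom. rewrite Rabs_pos_eq; lra.
    - simpl. f_equal. ring. }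
  apply is_lim_seq_le_le with (fun K => - L - A * Z * (2 / 3) ^ K)
    (fun K => - L + A * Z * (2 / 3) ^ K).
  - intros K. specialize (Hbound K). apply Rabs_le_between in Hbound. lra.
  - evar_last; [apply is_lim_seq_minus'; [apply is_lim_seq_const|exact Hgeom]|].
    f_equal. ring.
  - evar_last; [apply is_lim_seq_plus'; [apply is_lim_seq_const|exact Hgeom]|].
    f_equal. ring.
Qed.

Theorem theorem4 (m : nat) (hm : (2 <= m)%nat) :
  ex_RInt (fun x : R => zeta1 (INR m) x * zeta1 (INR m) (1 - x)) 0 1
  /\ ex_series (summand m)
  /\ RInt (fun x : R => zeta1 (INR m) x * zeta1 (INR m) (1 - x)) 0 1
     = 2 * Gamma (2 * INR m - 1) / (Gamma (INR m)) ^ 2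
         * ((digamma (INR m) - digamma (2 * INR m - 1)) * (zeta (2 * INR m - 1) - 1)
            - Derive zeta (2 * INR m - 1))
       - 2 * Series (summand m).
Proof.
  destruct m as [|p]; [lia|].
  assert (Hp : (1 <= p)%nat) by lia.
  replace (2 * INR (S p) - 1) with (INR (S (p + p)))
    by (rewrite !S_INR, plus_INR; ring).
  destruct (RInt_zeta1_product p Hp) as [l [Hl1 Hl2]].
  pose proof (is_series_summand p l Hp Hl2) as Hs.
  split; [exists l; exact Hl1|]. split; [eexists; exact Hs|].
  rewrite (is_RInt_unique _ _ _ _ Hl1), (is_series_unique _ _ Hs).
  rewrite binomial_harmonic, !Gamma_INR_S.
  pose proof (digamma_INR_add p p Hp) as Hd.
  change (S p + p)%nat with (S (p + p)) in Hd. rewrite Hd.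
  assert (HC : Binomial.C (p + p) p = INR (fact (p + p)) / INR (fact p) ^ 2).
  { unfold Binomial.C. replace (p + p - p)%nat with p by lia.
    field. apply INR_fact_neq_0. }
  match goal with |- ?a = ?b => change (@eq R a b) end.
  rewrite HC. field. apply INR_fact_neq_0.
Qed.
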